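(* Let $\delta_1,\delta_2$ be real constants, $\alpha\in(-\pi,\pi)$ with $\alpha\neq0$, and $\theta\in(-\pi,\pi)$ with $\theta\ne0$. The Bäcklund transformation with parameter $\alpha$ of the straight line with initial value $s_b(0,0)=e^{i\theta}$, together with its associated family with spectral parameter $\lambda=e^t$, $t\in\mathbb{R}$, is given by $$f_b(k,\ell,\alpha,t)=f_0(k,\ell,t)+\frac{\sin\alpha}{\cosh t-\cos\alpha\sinh t}\begin{bmatrix}\tanh\chi\\-\operatorname{sech}\chi\,\operatorname{Re}\omega\\ \operatorname{sech}\chi\,\operatorname{Im}\omega\end{bmatrix}$$ with $$n_b(k,\ell,\alpha,t)=\frac{\sin\alpha}{\cosh t-\cos\alpha\sinh t}\begin{bmatrix}\operatorname{sech}\chi\\ \operatorname{Im}\hat\omega\\ \operatorname{Re}\hat\omega\end{bmatrix},$$ where $$\chi(k,\ell,\alpha)=\log\tan\frac\theta2+k\log\frac{\sin\alpha+\sin\delta_1}{\sin\alpha-\sin\delta_1}-\ell\log\frac{\sin(\alpha-\delta_2)}{\sin(\alpha+\delta_2)},$$ $$\hat\omega=\omega\,\bigl(i\tanh\chi+(\cosh t\cot\alpha-\csc\alpha\sinh t)\bigr),$$ $f_0(k,\ell,t)=(-2x(k,\ell,t),0,0)$, and $$x(k,\ell,t)=k\,\frac{\cosh t\sin\delta_1}{1+\sinh^2t\sin^2\delta_1}+\ell\,\frac{\sinh t\sin\delta_2\cos\delta_2}{1+\sinh^2t\sin^2\delta_2},$$ $$\omega(k,\ell,t)=\left(\frac{i+\sinh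 t\sin\delta_1}{i-\sinh t\sin\delta_1}\right)^k\left(\frac{i+\cosh t\tan\delta_2}{i-\cosh t\tan\delta_2}\right)^\ell.$$
   Context: Quaternions: $\mathbb{H}$ is the real span of the $2\times2$ matrices $\mathbb{1},-i\sigma_1,-i\sigma_2,-i\sigma_3$, with Pauli matrices $\sigma_1=\begin{pmatrix}0&1\\1&0\end{pmatrix}$, $\sigma_2=\begin{pmatrix}0&-i\\i&0\end{pmatrix}$, $\sigma_3=\begin{pmatrix}1&0\\0&-1\end{pmatrix}$. $\mathbb{R}^3$ is identified with trace-free quaternions by $(x_1,x_2,x_3)\leftrightarrow\sum_jx_j(-i\sigma_j)$; $[X]^{\mathrm{tr}=0}$ is the trace-free part. For a map $g$ on $\mathbb{Z}^2$: $g=g(k,\ell)$, $g_1=g(k+1,\ell)$, $g_2=g(k,\ell+1)$ ($\delta_1,\delta_2$ are not shifts). Lax matrices: for a unitary vertex function $s$ and edge functions $l,m$ and spectral parameter $\lambda=e^t$, $$L=\begin{pmatrix}\cot\frac{\delta_1}2\frac{l}{s}+\tan\frac{\delta_1}2\,l s_1& i(\lambda-\frac{ss_1}{\lambda})\\ i(\lambda-\frac{1}{\lambda ss_1})&\cot\frac{\delta_1}2\frac{s}{l}+\tan\frac{\delta_1}2\frac{1}{l s_1}\end{pmatrix},\quad M=\begin{pmatrix}\cot\frac{\delta_2}2\frac{m}{s}+\tan\frac{\delta_2}2\,m s_2& i(\lambda-\frac{ss_2}{\lambda})\\ i(\lambda-\frac{1}{\lambda ss_2})&\cot\frac{\delta_2}2\frac{s}{m}+\tan\frac{\delta_2}2\frac{1}{m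 s_2}\end{pmatrix}.$$ The net with frame $\Phi$ ($\Phi_1=L\Phi$, $\Phi_2=M\Phi$) is $f=2[\Phi^{-1}\partial_t\Phi]^{\mathrm{tr}=0}$, $n=-i\Phi^{-1}\sigma_3\Phi$; varying $t$ gives its associated family. Straight line: the case $s_0(k,\ell)=l_0(k,\ell)=m_0(k,\ell)=(-1)^\ell$, with frame $\Phi_0$, $\Phi_0(0,0)=\mathbb{1}$; its net is $f_0=(-2x,0,0)$, $n_0=(0,\operatorname{Im}\omega,\operatorname{Re}\omega)$. Bäcklund transformation with parameter $\alpha$ of the straight line with $s_b(0,0)=e^{i\theta}$: $s_b$ is the unitary vertex function with this initial value for which the matrices $$U=\begin{pmatrix}\cot\frac\alpha2\,\frac{s_b}{s_0}& i\lambda\\ i\lambda&\cot\frac\alpha2\,\frac{s_0}{s_b}\end{pmatrix}$$ satisfy $U_1L=\tilde LU$ and $U_2M=\tilde MU$ for all $\lambda$, where $L,M$ are the Lax matrices of the straight line and $\tilde L,\tilde M$ are the Lax matrices (same $\delta_1,\delta_2$) with vertex function $s_b$ and suitable edge functions $\tilde l,\tilde m$, i.e., writing $s_{b,1}=s_b(k+1,\ell)$ and $s_{b,2}=s_b(k,\ell+1)$, $$\tilde L=\begin{pmatrix}\cot\frac{\delta_1}2\frac{\tilde l}{s_b}+\tan\frac{\delta_1}2\,\tilde l s_{b,1}& i(\lambda-\frac{s_bs_{b,1}}{\lambda})\\ i(\lambda-\frac{1}{\lambda s_bs_{b,1}})&\cot\frac{\delta_1}2\frac{s_b}{\tilde l}+\tan\frac{\delta_1}2\frac{1}{\tilde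 l s_{b,1}}\end{pmatrix},\quad \tilde M=\begin{pmatrix}\cot\frac{\delta_2}2\frac{\tilde m}{s_b}+\tan\frac{\delta_2}2\,\tilde m s_{b,2}& i(\lambda-\frac{s_bs_{b,2}}{\lambda})\\ i(\lambda-\frac{1}{\lambda s_bs_{b,2}})&\cot\frac{\delta_2}2\frac{s_b}{\tilde m}+\tan\frac{\delta_2}2\frac{1}{\tilde m s_{b,2}}\end{pmatrix}.$$ The transformed net and its associated family $(f_b,n_b)$ have frame $\Phi_b=U\Phi_0$. Parameters are such that all expressions are defined (e.g. $\sin\delta_1\ne0$, $\sin\delta_2\cos\delta_2\neq0$, $\sin\alpha\neq\pm\sin\delta_1$, $\sin(\alpha\pm\delta_2)\ne0$). Only $e^{\chi}$ enters the formulas; when an argument of a logarithm is negative, $\chi$ is understood through $e^\chi$. *)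

(* Defs.v *)
From HB Require Import structures.
From mathcomp Require Import all_boot all_order all_algebra.
From mathcomp Require Import complex.
From mathcomp Require Import all_classical all_reals all_analysis.

Set Implicit Arguments.
Unset Strict Implicit.
Unset Printing Implicit Defensive.

Import Order.TTheory GRing.Theory Num.Theory.
Import numFieldNormedType.Exports.

Local Open Scope ring_scope.
Local Open Scope complex_scope.

Definition cosh {R : realType} (t : R) : R := (expR t + expR (- t)) / 2.
Definition sinh {R : realType} (t : R) : R := (expR t - expR (- t)) / 2.
Definition cot {R : realType} (a : R) : R := cos a / sin a.
Definition csc {R : realType} (a : R) : R := (sin a)^-1.

(* Hyperbolic tangent and secant of chi as functions of u = e^chi; they make
   sense for every real u != 0, in particular for the negative u that arise when
   chi is a sum of logarithms of possibly negative numbers. *)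
Definition tanh_exp {R : realType} (u : R) : R := (u - u^-1) / (u + u^-1).
Definition sech_exp {R : realType} (u : R) : R := 2 / (u + u^-1).

Definition vec3 {R : realType} (x y z : R) : 'rV[R]_3 :=
  \row_(j < 3) [:: x; y; z]`_j.

Definition mx2 {R : realType} (a b c d : R[i]) : 'M[R[i]]_2 :=
  \matrix_(i < 2, j < 2)
    if i == 0 then (if j == 0 then a else b) else (if j == 0 then c else d).

Definition sigma1 (R : realType) : 'M[R[i]]_2 := mx2 0 1 1 0.
Definition sigma2 (R : realType) : 'M[R[i]]_2 := mx2 0 (- 'i%C) 'i%C 0.
Definition sigma3 (R : realType) : 'M[R[i]]_2 := mx2 1 0 0 (- 1).

(* The identification of R^3 with the trace-free quaternions. *)
Definition imquat {R : realType} (v : 'rV[R]_3) : 'M[R[i]]_2 :=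
  \sum_(j < 3) (v 0 j)%:C *: (- 'i%C *: [:: sigma1 R; sigma2 R; sigma3 R]`_j).

Definition trfree {R : realType} (X : 'M[R[i]]_2) : 'M[R[i]]_2 :=
  X - (\tr X / 2)%:M.

(* Derivative of a matrix-valued function of a real variable, taken on the real
   and imaginary parts of the entries. *)
Definition dmx {R : realType} (F : R -> 'M[R[i]]_2) (t : R) : 'M[R[i]]_2 :=
  \matrix_(i < 2, j < 2)
    (derive1 (fun u : R => complex.Re (F u i j)) t +i*
     derive1 (fun u : R => complex.Im (F u i j)) t).

Definition net_f {R : realType} (Phi : R -> 'M[R[i]]_2) (t : R) : 'M[R[i]]_2 :=
  2 *: trfree (invmx (Phi t) *m dmx Phi t).

Definition net_n {R : realType} (Phi : R -> 'M[R[i]]_2) (t : R) : 'M[R[i]]_2 :=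
  - 'i%C *: (invmx (Phi t) *m sigma3 R *m Phi t).

(* Transport matrix across an edge with parameter d and edge variable e, from a
   vertex with variable s to a vertex with variable s'. *)
Definition lax {R : realType} (d : R) (s s' e : R[i]) (lambda : R) :
    'M[R[i]]_2 :=
  let lam := lambda%:C in
  let ct := (cot (d / 2))%:C in
  let tn := (tan (d / 2))%:C in
  mx2 (ct * (e / s) + tn * (e * s'))     ('i%C * (lam - s * s' / lam))
      ('i%C * (lam - (lam * (s * s'))^-1)) (ct * (s / e) + tn / (e * s')).

Definition laxL {R : realType} (d1 : R) (s l : int -> int -> R[i])
    (k ell : int) (lambda : R) : 'M[R[i]]_2 :=
  lax d1 (s k ell) (s (k + 1) ell) (l k ell) lambda.

Definition laxM {R : realType} (d2 : R) (s m : int -> int -> R[i])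
    (k ell : int) (lambda : R) : 'M[R[i]]_2 :=
  lax d2 (s k ell) (s k (ell + 1)) (m k ell) lambda.

Definition is_frame {R : realType} (d1 d2 : R) (s l m : int -> int -> R[i])
    (Phi : int -> int -> R -> 'M[R[i]]_2) : Prop :=
  forall (k ell : int) (t : R),
    Phi (k + 1) ell t = laxL d1 s l k ell (expR t) *m Phi k ell t /\
    Phi k (ell + 1) t = laxM d2 s m k ell (expR t) *m Phi k ell t.

Definition backU {R : realType} (alpha : R) (s sb : int -> int -> R[i])
    (k ell : int) (lambda : R) : 'M[R[i]]_2 :=
  let ct := (cot (alpha / 2))%:C in
  mx2 (ct * (sb k ell / s k ell)) ('i%C * lambda%:C)
      ('i%C * lambda%:C)            (ct * (s k ell / sb k ell)).

(* As lambda = e^t with t real, the spectral parameter is a positive real. *)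
Definition is_backlund {R : realType} (d1 d2 alpha theta : R)
    (s l m sb : int -> int -> R[i]) : Prop :=
  [/\ sb 0 0 = cos theta +i* sin theta,
      forall k ell : int, `|sb k ell| = 1 &
      exists lt mt : int -> int -> R[i],
        (forall k ell : int, `|lt k ell| = 1 /\ `|mt k ell| = 1) /\
        forall (k ell : int) (lambda : R), 0 < lambda ->
          backU alpha s sb (k + 1) ell lambda *m laxL d1 s l k ell lambda =
          laxL d1 sb lt k ell lambda *m backU alpha s sb k ell lambda /\
          backU alpha s sb k (ell + 1) lambda *m laxM d2 s m k ell lambda =
          laxM d2 sb mt k ell lambda *m backU alpha s sb k ell lambda].

(* For the straight line, the vertex function and both edge functions. *)
Definition straight (R : realType) (k ell : int) : R[i] := (- 1) ^ ell.

Definition is_straight_frame {R : realType} (d1 d2 : R)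
    (Phi : int -> int -> R -> 'M[R[i]]_2) : Prop :=
  is_frame d1 d2 (straight R) (straight R) (straight R) Phi /\
  forall t : R, Phi 0 0 t = 1%:M.

Definition is_straight_backlund {R : realType} (d1 d2 alpha theta : R)
    (sb : int -> int -> R[i]) : Prop :=
  is_backlund d1 d2 alpha theta (straight R) (straight R) (straight R) sb.

Definition backlund_frame {R : realType} (alpha : R) (sb : int -> int -> R[i])
    (Phi0 : int -> int -> R -> 'M[R[i]]_2) (k ell : int) (t : R) :
    'M[R[i]]_2 :=
  backU alpha (straight R) sb k ell (expR t) *m Phi0 k ell t.

Definition xline {R : realType} (d1 d2 : R) (k ell : int) (t : R) : R :=
  k%:~R * (cosh t * sin d1 / (1 + sinh t ^+ 2 * sin d1 ^+ 2)) +
  ell%:~R * (sinh t * sin d2 * cos d2 / (1 + sinh t ^+ 2 * sin d2 ^+ 2)).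

Definition omega {R : realType} (d1 d2 : R) (k ell : int) (t : R) : R[i] :=
  (('i%C + (sinh t * sin d1)%:C) / ('i%C - (sinh t * sin d1)%:C)) ^ k *
  (('i%C + (cosh t * tan d2)%:C) / ('i%C - (cosh t * tan d2)%:C)) ^ ell.

Definition f0 {R : realType} (d1 d2 : R) (k ell : int) (t : R) : 'rV[R]_3 :=
  vec3 (- 2 * xline d1 d2 k ell t) 0 0.

(* e^chi for chi = log tan (theta/2)
     + k log ((sin alpha + sin d1) / (sin alpha - sin d1))
     - ell log (sin (alpha - d2) / sin (alpha + d2)). *)
Definition expchi {R : realType} (d1 d2 alpha theta : R) (k ell : int) : R :=
  tan (theta / 2) *
  ((sin alpha + sin d1) / (sin alpha - sin d1)) ^ k *
  (sin (alpha - d2) / sin (alpha + d2)) ^ (- ell).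

Definition tanhchi {R : realType} (d1 d2 alpha theta : R) (k ell : int) : R :=
  tanh_exp (expchi d1 d2 alpha theta k ell).

Definition sechchi {R : realType} (d1 d2 alpha theta : R) (k ell : int) : R :=
  sech_exp (expchi d1 d2 alpha theta k ell).

Definition omegahat {R : realType} (d1 d2 alpha theta : R) (k ell : int)
    (t : R) : R[i] :=
  omega d1 d2 k ell t *
  ('i%C * (tanhchi d1 d2 alpha theta k ell)%:C +
   (cosh t * cot alpha - csc alpha * sinh t)%:C).

Definition amplitude {R : realType} (alpha t : R) : R :=
  sin alpha / (cosh t - cos alpha * sinh t).

Definition fb {R : realType} (d1 d2 alpha theta : R) (k ell : int) (t : R) :
    'rV[R]_3 :=
  f0 d1 d2 k ell t +
  amplitude alpha t *:
    vec3 (tanhchi d1 d2 alpha theta k ell)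
         (- (sechchi d1 d2 alpha theta k ell *
             complex.Re (omega d1 d2 k ell t)))
         (sechchi d1 d2 alpha theta k ell *
          complex.Im (omega d1 d2 k ell t)).

Definition nb {R : realType} (d1 d2 alpha theta : R) (k ell : int) (t : R) :
    'rV[R]_3 :=
  amplitude alpha t *:
    vec3 (sechchi d1 d2 alpha theta k ell)
         (complex.Im (omegahat d1 d2 alpha theta k ell t))
         (complex.Re (omegahat d1 d2 alpha theta k ell t)).

(* Main.v *)
Require Import Defs.
From mathcomp Require Import all_boot all_order all_algebra.
From mathcomp Require Import complex.
From mathcomp Require Import all_classical all_reals all_analysis.
From mathcomp Require Import ring lra.

Set Implicit Arguments.
Unset Strict Implicit.
Unset Printing Implicit Defensive.

Import Order.TTheory GRing.Theory Num.Theory.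
Import numFieldNormedType.Exports.
Local Open Scope ring_scope.
Local Open Scope complex_scope.

(** The Lax matrices of the straight line lie in the commutative algebra
spanned by 1 and sigma1.  With tan a1 = sinh t sin d1 and
tan a2 = cosh t tan d2 they are real multiples of exp(i a1 sigma1) and
exp(i a2 sigma1), so the frame at (k, ell) is a real multiple of
exp(i p sigma1) with p = k a1 + ell a2 ([line_frame], [line_frameP]).  The
trace-free part of the logarithmic derivative is i p' sigma1, and p' is the
coordinate x; conjugation by the frame rotates the (sigma2, sigma3)-plane by
the angle 2p, and omega = exp(-2ip) ([spin_conj], [omegaE]).

For the transformation, put r = s_b / s_0, c = cot(alpha/2),
C = cot(d/2), T = tan(d/2).  Let e = 1 on an edge in the first direction and
e = -1 on an edge in the second one, so that s_0 is multiplied by e along the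
edge, and let K = C + e T.  Comparing the coefficients of lambda in
U' L = L~ U leaves, up to complex conjugation, two equations for the new value
r' and the edge variable q:
  q (C + e T r r') = c (r r' - 1) + K r,
  c K (r' - r) = (c^2 + e) (r r' - 1).
The second one is a Moebius relation.  It determines r' from r, and r from r',
because r is unitary and (c K)^2 differs from (c^2 + e)^2, which is what the
conditions on the parameters say; hence uniqueness on the whole lattice
([mobius_inj], [line_backlund_unique]).  In the Cayley coordinate u, with
r = (1 + i u) / (1 - i u), it becomes c K (u' - u) = (c^2 + e) (u' + u), that
is, multiplication of u by the factor that e^chi acquires along the edge.
Therefore u = e^chi, with u = tan(theta/2) at the origin.  The first equation
then gives q, and q is unitary because numerator and denominator have the same
modulus ([edge_unit], [line_backlundP]).

For a product of frames, the net of U Phi_0 is the net of Phi_0 plus the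
conjugate by Phi_0 of the net of U ([net_f_mul], [net_n_mul]).  The
contribution of U is a two by two computation ([net_f_darboux],
[net_n_darboux]) with r = - tanh chi + i sech chi, and conjugation by Phi_0
rotates it by 2p; this is the stated formula. *)

(** * Complex numbers and complex matrices of size two *)

Lemma mulcE (R : realType) (a b c d : R) :
  (a +i* b) * (c +i* d) = (a * c - b * d) +i* (a * d + b * c) :> R[i].
Proof. by []. Qed.

Lemma addcE (R : realType) (a b c d : R) :
  (a +i* b) + (c +i* d) = (a + c) +i* (b + d) :> R[i].
Proof. by []. Qed.

Lemma oppcE (R : realType) (a b : R) : - (a +i* b) = (- a) +i* (- b) :> R[i].
Proof. by []. Qed.

Lemma realcE (R : realType) (a : R) : a%:C = a +i* 0.
Proof. by []. Qed.

Lemma onecE (R : realType) : 1 = 1 +i* 0 :> R[i].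
Proof. by []. Qed.

Lemma zerocE (R : realType) : 0 = 0 +i* 0 :> R[i].
Proof. by []. Qed.

(** Brings an expression over complex literals to the form [a +i* b], so
that identities can be checked in the real field, one component at a time. *)
Definition cE := (realcE, mulcE, addcE, oppcE).

Lemma sqr_im (R : realType) : 'i%C * 'i%C = -1 :> R[i].
Proof. by rewrite -expr2 sqr_i. Qed.

Lemma unit_neq0 (R : realType) (z : R[i]) : `|z| = 1 -> z != 0.
Proof. by move=> z1; rewrite -normr_eq0 z1 oner_neq0. Qed.

Lemma unit_conj (R : realType) (z : R[i]) : `|z| = 1 -> z^*%C = z^-1.
Proof. by move=> z1; rewrite invc_norm z1 expr1n invr1 mul1r. Qed.

Lemma sumsqr_neq0 (R : realType) (u : R) : 1 + u ^+ 2 != 0.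
Proof. by apply: lt0r_neq0; rewrite ltr_pwDl// sqr_ge0. Qed.

Lemma sqr1_neq0 (F : fieldType) (z : F) : z * z = 1 -> z != 0.
Proof.
by move=> h; apply/eqP => z0; move/eqP: h; rewrite z0 mul0r eq_sym oner_eq0.
Qed.

Lemma mx2_eq (R : realType) (a b c d a' b' c' d' : R[i]) :
  mx2 a b c d = mx2 a' b' c' d' -> [/\ a = a', b = b', c = c' & d = d'].
Proof.
move=> /matrixP h.
by split; [have := h 0 0 | have := h 0 1 | have := h 1 0 | have := h 1 1];
  rewrite !mxE.
Qed.

Lemma mx2_mul (R : realType) (a b c d a' b' c' d' : R[i]) :
  mx2 a b c d *m mx2 a' b' c' d' =
  mx2 (a * a' + b * c') (a * b' + b * d') (c * a' + d * c') (c * b' + d * d').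
Proof.
apply/matrixP => i j; rewrite !mxE !big_ord_recl big_ord0 addr0 !mxE /=.
by case: (i == 0); case: (j == 0).
Qed.

Lemma mx2_scale (R : realType) (z a b c d : R[i]) :
  z *: mx2 a b c d = mx2 (z * a) (z * b) (z * c) (z * d).
Proof.
by apply/matrixP => i j; rewrite !mxE; case: (i == 0); case: (j == 0).
Qed.

Lemma mx2_add (R : realType) (a b c d a' b' c' d' : R[i]) :
  mx2 a b c d + mx2 a' b' c' d' = mx2 (a + a') (b + b') (c + c') (d + d').
Proof.
by apply/matrixP => i j; rewrite !mxE; case: (i == 0); case: (j == 0).
Qed.

Lemma mx2_scalar (R : realType) (a : R[i]) : a%:M = mx2 a 0 0 a.
Proof.
apply/matrixP => i j; rewrite !mxE.
by case: i => [[|[|//]] ?]; case: j => [[|[|//]] ?].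
Qed.

Lemma mx2_tr (R : realType) (a b c d : R[i]) : \tr (mx2 a b c d) = a + d.
Proof. by rewrite /mxtrace !big_ord_recl big_ord0 !mxE /= addr0. Qed.

Lemma mx2_inv (R : realType) (a b c d : R[i]) : a * d - b * c != 0 ->
  mx2 a b c d \in unitmx /\
  invmx (mx2 a b c d) = (a * d - b * c)^-1 *: mx2 d (- b) (- c) a.
Proof.
move=> D0.
have E : mx2 a b c d *m
    ((a * d - b * c)^-1 *: mx2 d (- b) (- c) a) = 1%:M.
  rewrite -scalemxAr mx2_mul mx2_scalar mx2_scale.
  rewrite !mulrN [b * a]mulrC [d * c]mulrC [d * a]mulrC [c * b]mulrC.
  by rewrite ![- _ + _]addrC !subrr mulr0 mulVf.
have [u _] := mulmx1_unit E; split=> //.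
by rewrite -[RHS](mulKmx u) E mulmx1.
Qed.

Lemma subr_half_sum (F : numFieldType) (a d : F) :
  a - (a + d) / 2 = (a - d) / 2.
Proof. by field. Qed.

Lemma trfree_mx2 (R : realType) (a b c d : R[i]) :
  trfree (mx2 a b c d) = mx2 ((a - d) / 2) b c ((d - a) / 2).
Proof.
rewrite /trfree mx2_tr mx2_scalar -scaleN1r mx2_scale mx2_add.
by rewrite !mulN1r oppr0 !addr0 subr_half_sum [a + d]addrC subr_half_sum.
Qed.

Lemma invmx_mul (R : realType) (A B : 'M[R[i]]_2) :
  A \in unitmx -> B \in unitmx -> invmx (A *m B) = invmx B *m invmx A.
Proof.
move=> Au Bu.
have ABu : A *m B \in unitmx by rewrite unitmx_mul Au Bu.
apply: (can_inj (mulmxK ABu)); rewrite mulVmx// mulmxA -(mulmxA (invmx B)).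
by rewrite mulVmx// mulmx1 mulVmx.
Qed.

Lemma imquat_vec3 (R : realType) (x y z : R) :
  imquat (vec3 x y z) = mx2 (0 -i* z) ((- y) -i* x) (y -i* x) (0 +i* z).
Proof.
rewrite /imquat; do 3 rewrite big_ord_recl.
rewrite [X in _ + (_ + (_ + X))]big_ord0 [X in _ + (_ + X)]addr0 !mxE.
rewrite [nth _ _ _]/= [nth _ _ (lift _ _)]/= [nth _ _ (lift _ _)]/=.
rewrite [nth _ _ (lift _ (lift _ _))]/= [nth _ _ (lift _ (lift _ _))]/=.
rewrite /sigma1 /sigma2 /sigma3 !mx2_scale !mx2_add.
rewrite !(onecE, zerocE, cE).
by congr mx2; congr Complex; ring.
Qed.

Lemma imquatD (R : realType) (v w : 'rV[R]_3) :
  imquat (v + w) = imquat v + imquat w.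
Proof.
rewrite /imquat -big_split; apply: eq_bigr => j _.
by rewrite mxE rmorphD scalerDl.
Qed.

Lemma vec3_scale (R : realType) (a x y z : R) :
  a *: vec3 x y z = vec3 (a * x) (a * y) (a * z).
Proof.
apply/rowP => j; rewrite !mxE.
by case: j => [[|[|[|//]]] ?].
Qed.

(** * Derivatives of matrix functions *)

Lemma is_derive_mul (R : realType) (f g : R -> R) (t a b : R) :
    is_derive t 1 f a -> is_derive t 1 g b ->
  is_derive t 1 (fun u => f u * g u) (a * g t + f t * b).
Proof.
move=> fa gb; apply: (is_derive_eq (is_deriveM fa gb)).
by rewrite addrC [g t *: a]mulrC.
Qed.

Lemma is_derive_add (R : realType) (f g : R -> R) (t a b : R) :
    is_derive t 1 f a -> is_derive t 1 g b ->
  is_derive t 1 (fun u => f u + g u) (a + b).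
Proof. by move=> fa gb; exact: is_deriveD. Qed.

Lemma is_derive_sub (R : realType) (f g : R -> R) (t a b : R) :
    is_derive t 1 f a -> is_derive t 1 g b ->
  is_derive t 1 (fun u => f u - g u) (a - b).
Proof. by move=> fa gb; exact: is_deriveB. Qed.

Lemma is_derive_opp (R : realType) (f : R -> R) (t a : R) :
    is_derive t 1 f a -> is_derive t 1 (fun u => - f u) (- a).
Proof. by move=> fa; exact: is_deriveN. Qed.

Lemma is_derive_const (R : realType) (c t : R) :
  is_derive t 1 (fun _ => c) 0.
Proof. exact: is_derive_cst. Qed.

Lemma is_derive_chain (R : realType) (f g : R -> R) (t a b : R) :
    is_derive t 1 g b -> is_derive (g t) 1 f a ->
  is_derive t 1 (fun u => f (g u)) (a * b).
Proof. by move=> gb fa; exact: is_derive1_comp. Qed.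

(** Unlike [dmx], which is total, this relation asserts that the entries are
differentiable; the product rule needs that. *)
Definition is_dmx (R : realType) (F : R -> 'M[R[i]]_2) (t : R)
    (F' : 'M[R[i]]_2) : Prop :=
  forall i j : 'I_2,
    is_derive t 1 (fun u => complex.Re (F u i j)) (complex.Re (F' i j)) /\
    is_derive t 1 (fun u => complex.Im (F u i j)) (complex.Im (F' i j)).

Lemma is_dmxE (R : realType) (F : R -> 'M[R[i]]_2) (t : R) F' :
  is_dmx F t F' -> dmx F t = F'.
Proof.
move=> dF; apply/matrixP => i j; rewrite mxE !derive1E.
have [dRe dIm] := dF i j.
rewrite (@derive_val _ _ _ _ _ _ _ dRe) (@derive_val _ _ _ _ _ _ _ dIm).
by rewrite [RHS]complexE; simpc.
Qed.

Lemma is_dmx_mul (R : realType) (F G : R -> 'M[R[i]]_2) (t : R) F' G' :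
    is_dmx F t F' -> is_dmx G t G' ->
  is_dmx (fun u => F u *m G u) t (F' *m G t + F t *m G').
Proof.
move=> dF dG i j.
have ReE (A B : 'M[R[i]]_2) : complex.Re ((A *m B) i j) =
    complex.Re (A i 0) * complex.Re (B 0 j) -
    complex.Im (A i 0) * complex.Im (B 0 j) +
    (complex.Re (A i 1) * complex.Re (B 1 j) -
     complex.Im (A i 1) * complex.Im (B 1 j)).
  rewrite mxE !big_ord_recl big_ord0 addr0.
  rewrite (_ : lift _ _ = 1); last exact/val_inj.
  by case: (A i 0) (A i 1) (B 0 j) (B 1 j) => [? ?] [? ?] [? ?] [? ?].
have ImE (A B : 'M[R[i]]_2) : complex.Im ((A *m B) i j) =
    complex.Re (A i 0) * complex.Im (B 0 j) +
    complex.Im (A i 0) * complex.Re (B 0 j) +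
    (complex.Re (A i 1) * complex.Im (B 1 j) +
     complex.Im (A i 1) * complex.Re (B 1 j)).
  rewrite mxE !big_ord_recl big_ord0 addr0.
  rewrite (_ : lift _ _ = 1); last exact/val_inj.
  by case: (A i 0) (A i 1) (B 0 j) (B 1 j) => [? ?] [? ?] [? ?] [? ?].
have ReD (z w : R[i]) : complex.Re (z + w) = complex.Re z + complex.Re w
  by case: z w => [? ?] [? ?].
have ImD (z w : R[i]) : complex.Im (z + w) = complex.Im z + complex.Im w
  by case: z w => [? ?] [? ?].
have [Fr0 Fi0] := dF i 0; have [Fr1 Fi1] := dF i 1.
have [Gr0 Gi0] := dG 0 j; have [Gr1 Gi1] := dG 1 j.
split.
- rewrite mxE ReD !ReE.
  under eq_fun do rewrite ReE.
  apply: (is_derive_eq (is_derive_add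
    (is_derive_sub (is_derive_mul Fr0 Gr0) (is_derive_mul Fi0 Gi0))
    (is_derive_sub (is_derive_mul Fr1 Gr1) (is_derive_mul Fi1 Gi1)))).
  by ring.
- rewrite mxE ImD !ImE.
  under eq_fun do rewrite ImE.
  apply: (is_derive_eq (is_derive_add
    (is_derive_add (is_derive_mul Fr0 Gi0) (is_derive_mul Fi0 Gr0))
    (is_derive_add (is_derive_mul Fr1 Gi1) (is_derive_mul Fi1 Gr1)))).
  by ring.
Qed.

Definition is_dcomplex (R : realType) (z : R -> R[i]) (t : R)
    (z' : R[i]) : Prop :=
  is_derive t 1 (fun u => complex.Re (z u)) (complex.Re z') /\
  is_derive t 1 (fun u => complex.Im (z u)) (complex.Im z').

Lemma is_dmx_mx2 (R : realType) (a b c d : R -> R[i]) (t : R) a' b' c' d' :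
    is_dcomplex a t a' -> is_dcomplex b t b' ->
    is_dcomplex c t c' -> is_dcomplex d t d' ->
  is_dmx (fun u => mx2 (a u) (b u) (c u) (d u)) t (mx2 a' b' c' d').
Proof.
move=> da db dc dd i j; rewrite mxE; under eq_fun do rewrite mxE.
under [X in _ /\ is_derive _ _ X _]eq_fun do rewrite mxE.
by case: (i == 0); case: (j == 0).
Qed.

(** * Nets of products of frames *)

Lemma trfreeD (R : realType) (X Y : 'M[R[i]]_2) :
  trfree (X + Y) = trfree X + trfree Y.
Proof. by rewrite /trfree mxtraceD mulrDl raddfD opprD addrACA. Qed.

Lemma trfree_conj (R : realType) (P X : 'M[R[i]]_2) : P \in unitmx ->
  trfree (invmx P *m X *m P) = invmx P *m trfree X *m P.
Proof.
move=> Pu; rewrite /trfree mxtrace_mulC mulmxA mulmxV// mul1mx.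
by rewrite mulmxBr mulmxBl mul_mx_scalar -scalemxAl mulVmx// scalemx1.
Qed.

(** The logarithmic derivative of [F G] is that of [G] plus the conjugate by
[G] of that of [F], and taking the trace-free part commutes with conjugation. *)
Lemma net_f_mul (R : realType) (F G : R -> 'M[R[i]]_2) (t : R) F' G' :
    is_dmx F t F' -> is_dmx G t G' -> F t \in unitmx -> G t \in unitmx ->
  net_f (fun u => F u *m G u) t =
    net_f G t + invmx (G t) *m net_f F t *m G t.
Proof.
move=> dF dG Fu Gu; rewrite /net_f (is_dmxE (is_dmx_mul dF dG)).
rewrite (is_dmxE dF) (is_dmxE dG) invmx_mul//.
rewrite -scalemxAr -scalemxAl -scalerDr -trfree_conj// -trfreeD.
rewrite addrC mulmxDr; congr (_ *: trfree (_ + _)).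
  by rewrite !mulmxA -(mulmxA _ _ (F t)) mulVmx// mulmx1.
by rewrite !mulmxA.
Qed.

Lemma net_n_mul (R : realType) (F G : R -> 'M[R[i]]_2) (t : R) :
    F t \in unitmx -> G t \in unitmx ->
  net_n (fun u => F u *m G u) t = invmx (G t) *m net_n F t *m G t.
Proof.
move=> Fu Gu; rewrite /net_n invmx_mul//.
by rewrite -scalemxAr -scalemxAl !mulmxA.
Qed.

(** * Rotations about the first axis *)

(** This is exp(i p sigma1). *)
Definition spin (R : realType) (p : R) : 'M[R[i]]_2 :=
  mx2 (cos p)%:C (0 +i* sin p) (0 +i* sin p) (cos p)%:C.

Lemma spinD (R : realType) (p q : R) : spin (p + q) = spin p *m spin q.
Proof.
rewrite /spin mx2_mul sinD cosD !cE.
by congr mx2; congr Complex; ring.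
Qed.

Lemma spin0 (R : realType) : spin 0 = 1%:M :> 'M[R[i]]_2.
Proof. by rewrite /spin sin0 cos0 mx2_scalar. Qed.

Lemma spinNK (R : realType) (p : R) : spin (- p) *m spin p = 1%:M.
Proof. by rewrite -spinD addNr spin0. Qed.

Lemma spin_unit (R : realType) (p : R) : spin p \in unitmx.
Proof. by have [_] := mulmx1_unit (spinNK p). Qed.

Lemma spin_inv (R : realType) (p : R) : invmx (spin p) = spin (- p).
Proof.
by apply: (can_inj (mulmxK (spin_unit p))); rewrite mulVmx ?spin_unit// spinNK.
Qed.

(** The matrices sigma2 and sigma3 anticommute with sigma1, so conjugation
moves exp(i p sigma1) to one side, where it occurs twice: the angle doubles. *)
Lemma spin_conj (R : realType) (p x y z : R) :
  spin (- p) *m imquat (vec3 x y z) *m spin p =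
  imquat (vec3 x (y * cos (2 * p) - z * sin (2 * p))
                 (y * sin (2 * p) + z * cos (2 * p))).
Proof.
rewrite !imquat_vec3 /spin !mx2_mul sinN cosN mulr_natl mulr2n sinD cosD.
have h := cos2Dsin2 p.
set c := cos p in h *; set s := sin p in h *.
(* The first coordinate is not rotated and appears with the factor 1. *)
have xE : x = x * (c ^+ 2 + s ^+ 2) by rewrite h mulr1.
rewrite !cE; congr mx2; congr Complex; rewrite 1?[in RHS]xE; ring.
Qed.

Lemma scale_spinE (R : realType) (g p : R) :
  g%:C *: spin p =
  mx2 (g * cos p)%:C (0 +i* (g * sin p)) (0 +i* (g * sin p)) (g * cos p)%:C.
Proof.
by rewrite /spin mx2_scale !cE; congr mx2; congr Complex; ring.
Qed.

Lemma scale_spin_unit (R : realType) (g p : R) :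
  g != 0 -> g%:C *: spin p \in unitmx.
Proof.
by move=> g0; rewrite unitmxZ ?spin_unit// unitfE eq_complex /= eqxx andbT.
Qed.

Lemma scale_spinM (R : realType) (g h p q : R) :
  (g%:C *: spin p) *m (h%:C *: spin q) = (g * h)%:C *: spin (p + q).
Proof. by rewrite -scalemxAl -scalemxAr scalerA -rmorphM spinD. Qed.

Lemma conj_scale_spin (R : realType) (g p : R) (X : 'M[R[i]]_2) : g != 0 ->
  invmx (g%:C *: spin p) *m X *m (g%:C *: spin p) = spin (- p) *m X *m spin p.
Proof.
move=> g0; have gC : g%:C != 0 :> R[i] by rewrite eq_complex /= eqxx andbT.
rewrite invmxZ ?unitmxZ ?spin_unit ?unitfE// spin_inv.
by rewrite -!scalemxAl -scalemxAr scalerA mulVf// scale1r.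
Qed.

Lemma is_dmx_spin (R : realType) (g p : R -> R) (t g' p' : R) :
    g t != 0 -> is_derive t 1 g g' -> is_derive t 1 p p' ->
  is_dmx (fun u => (g u)%:C *: spin (p u)) t
    ((g t)%:C *: spin (p t) *m
       mx2 (g' / g t)%:C (0 +i* p') (0 +i* p') (g' / g t)%:C).
Proof.
move=> g0 dg dp.
have dcos := is_derive_mul dg (is_derive_chain dp (is_derive_cos (p t))).
have dsin := is_derive_mul dg (is_derive_chain dp (is_derive_sin (p t))).
have d0 := @is_derive_const R 0 t.
rewrite scale_spinE mx2_mul !cE; under eq_fun do rewrite scale_spinE.
apply: is_dmx_mx2; split;
  [ apply: (is_derive_eq dcos) | apply: (is_derive_eq d0)
  | apply: (is_derive_eq d0) | apply: (is_derive_eq dsin)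
  | apply: (is_derive_eq d0) | apply: (is_derive_eq dsin)
  | apply: (is_derive_eq dcos) | apply: (is_derive_eq d0) ];
  rewrite [RHS]/=; field; exact: g0.
Qed.

(** The real factor only contributes to the trace of the logarithmic
derivative, so the net sees the angle alone. *)
Lemma net_f_spin (R : realType) (g p : R -> R) (t g' p' : R) :
    g t != 0 -> is_derive t 1 g g' -> is_derive t 1 p p' ->
  net_f (fun u => (g u)%:C *: spin (p u)) t = imquat (vec3 (- 2 * p') 0 0).
Proof.
move=> g0 dg dp; rewrite /net_f (is_dmxE (is_dmx_spin g0 dg dp)).
rewrite (mulKmx (scale_spin_unit (p t) g0)) trfree_mx2 mx2_scale imquat_vec3.
rewrite subrr mul0r mulr0 !(onecE, zerocE, cE).
by congr mx2; congr Complex; ring.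
Qed.

(** * Induction on the lattice *)

Lemma int_ind_step (P : int -> Prop) :
    P 0 -> (forall k, P k -> P (k + 1)) -> (forall k, P (k + 1) -> P k) ->
  forall k, P k.
Proof.
move=> P0 up down; elim/int_ind => [//|n /up|n Pn].
  by rewrite -addn1 PoszD.
by apply: down; rewrite -addn1 PoszD opprD subrK.
Qed.

Lemma int2_ind_step (P : int -> int -> Prop) :
    P 0 0 -> (forall k ell, P k ell -> P (k + 1) ell) ->
    (forall k ell, P (k + 1) ell -> P k ell) ->
    (forall k ell, P k ell -> P k (ell + 1)) ->
    (forall k ell, P k (ell + 1) -> P k ell) ->
  forall k ell, P k ell.
Proof.
move=> P00 up down right left k ell.
elim/int_ind_step: ell => [|ell|ell]; [|exact: right|exact: left].
by elim/int_ind_step: k => [//|k|k]; [exact: up|exact: down].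
Qed.

(** * The frame of the straight line *)

Definition cis (R : realType) (p : R) : R[i] := cos p +i* sin p.

Lemma cisD (R : realType) (p q : R) : cis (p + q) = cis p * cis q.
Proof. by rewrite /cis mulcE sinD cosD; congr Complex; ring. Qed.

Lemma cis0 (R : realType) : cis 0 = 1 :> R[i].
Proof. by rewrite /cis sin0 cos0. Qed.

Lemma cisNK (R : realType) (p : R) : cis (- p) * cis p = 1.
Proof. by rewrite -cisD addNr cis0. Qed.

Lemma cis_neq0 (R : realType) (p : R) : cis p != 0.
Proof.
by apply/eqP => p0; have /eqP := cisNK p; rewrite p0 mulr0 eq_sym oner_eq0.
Qed.

Lemma cisXz (R : realType) (p : R) (k : int) : cis p ^ k = cis (k%:~R * p).
Proof.
elim/int_ind_step: k => [|k IH|k IH]; first by rewrite expr0z mul0r cis0.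
- by rewrite expfzDr ?cis_neq0// IH expr1z intrD mulrDl mul1r cisD.
- apply: (mulIf (cis_neq0 p)).
  rewrite -{2}[cis p]expr1z -expfzDr ?cis_neq0//.
  by rewrite IH intrD mulrDl mul1r cisD.
Qed.

(** With [tan a] for the real part of the numerator, both numerator and
denominator are [i / cos a] times a unit number, of angle [- a] and [a]. *)
Lemma cayley_tan (R : realType) (a : R) : cos a != 0 ->
  ('i%C + (tan a)%:C) / ('i%C - (tan a)%:C) = cis (- (2 * a)).
Proof.
move=> c0.
have iE : 'i%C - (tan a)%:C = 'i%C * (cos a)^-1%:C * cis a.
  by rewrite /cis /tan !cE; congr Complex; field; exact: c0.
have d0 : 'i%C - (tan a)%:C != 0.
  rewrite iE; apply: mulf_neq0 (cis_neq0 a); apply: mulf_neq0.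
    by rewrite eq_complex /= negb_and oner_eq0 orbT.
  by rewrite eq_complex /= negb_and invr_eq0 c0.
apply: (canLR (mulfK d0)); rewrite iE [RHS]mulrC -[RHS]mulrA -cisD.
have -> : a - 2 * a = - a by ring.
by rewrite /cis /tan sinN cosN !cE; congr Complex; field; exact: c0.
Qed.

Lemma sin_double_half (R : realType) (x : R) :
  sin x = 2 * sin (x / 2) * cos (x / 2).
Proof. by rewrite {1}[x]splitr sinD; ring. Qed.

Lemma cos_double_half (R : realType) (x : R) :
  cos x = cos (x / 2) ^+ 2 - sin (x / 2) ^+ 2.
Proof. by rewrite {1}[x]splitr cosD; ring. Qed.

Lemma half_neq0 (R : realType) (x : R) :
  sin x != 0 -> sin (x / 2) != 0 /\ cos (x / 2) != 0.
Proof.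
by rewrite (sin_double_half x) !mulf_eq0 !negb_or => /andP[/andP[_ ->] ->].
Qed.

Lemma cot_half_tan_half (R : realType) (x : R) :
  sin x != 0 -> cot (x / 2) * tan (x / 2) = 1.
Proof.
by move=> /half_neq0[s0 c0]; rewrite /cot /tan; field; rewrite s0 c0.
Qed.

Lemma cotDtan_half (R : realType) (x : R) :
  sin x != 0 -> cot (x / 2) + tan (x / 2) = 2 / sin x.
Proof.
move=> /half_neq0[s0 c0]; rewrite /cot /tan (sin_double_half x).
have -> : 2 / (2 * sin (x / 2) * cos (x / 2)) =
    2 * (cos (x / 2) ^+ 2 + sin (x / 2) ^+ 2) /
      (2 * sin (x / 2) * cos (x / 2)).
  by rewrite cos2Dsin2 mulr1.
by field; rewrite s0 c0.
Qed.

Lemma cotBtan_half (R : realType) (x : R) :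
  sin x != 0 -> cot (x / 2) - tan (x / 2) = 2 * cos x / sin x.
Proof.
move=> /half_neq0[s0 c0]; rewrite /cot /tan.
by rewrite (sin_double_half x) (cos_double_half x); field; rewrite s0 c0.
Qed.

Lemma sqr_cot_halfD1 (R : realType) (x : R) :
  sin x != 0 -> cot (x / 2) ^+ 2 + 1 = 2 * cot (x / 2) / sin x.
Proof.
move=> s0; transitivity (cot (x / 2) * (cot (x / 2) + tan (x / 2))).
  by rewrite mulrDr cot_half_tan_half.
by rewrite cotDtan_half//; ring.
Qed.

Lemma sqr_cot_halfB1 (R : realType) (x : R) :
  sin x != 0 -> cot (x / 2) ^+ 2 - 1 = 2 * cot (x / 2) * cos x / sin x.
Proof.
move=> s0; transitivity (cot (x / 2) * (cot (x / 2) - tan (x / 2))).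
  by rewrite mulrBr cot_half_tan_half.
by rewrite cotBtan_half//; ring.
Qed.

Lemma sin_neq0_pi (R : realType) (x : R) :
  - pi < x < pi -> x != 0 -> sin x != 0.
Proof.
move=> /andP[xl xu]; rewrite neq_lt => /orP[x0|x0]; last first.
  by rewrite gt_eqF// sin_gt0_pi// x0.
by rewrite -oppr_eq0 -sinN gt_eqF// sin_gt0_pi// oppr_gt0 x0 ltrNl.
Qed.

Lemma cos_atan_gt0 (R : realType) (x : R) : 0 < cos (atan x).
Proof. by rewrite cos_gt0_pihalf// atan_gtNpi2 atan_ltpi2. Qed.

Lemma cos_atan_neq0 (R : realType) (x : R) : cos (atan x) != 0.
Proof. by rewrite gt_eqF// cos_atan_gt0. Qed.

Lemma expR_ln_cos (R : realType) (x : R) :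
  expR (- ln (cos (atan x))) = (cos (atan x))^-1.
Proof. by rewrite expRN lnK// posrE cos_atan_gt0. Qed.

Definition angle1 (R : realType) (d1 t : R) : R := atan (sinh t * sin d1).

Definition angle2 (R : realType) (d2 t : R) : R := atan (cosh t * tan d2).

Definition phase (R : realType) (d1 d2 : R) (k ell : int) (t : R) : R :=
  k%:~R * angle1 d1 t + ell%:~R * angle2 d2 t.

(** Each factor of omega is [exp(- 2 i a)] with [a] the angle of the
corresponding Lax matrix. *)
Lemma omegaE (R : realType) (d1 d2 : R) (k ell : int) (t : R) :
  omega d1 d2 k ell t = cis (- (2 * phase d1 d2 k ell t)).
Proof.
rewrite /omega -[sinh t * _]atanK -[cosh t * _]atanK.
rewrite !cayley_tan ?cos_atan_neq0// !cisXz -cisD /phase /angle1 /angle2.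
by congr cis; ring.
Qed.

(** The modulus of a Lax matrix involves [1 / cos a]; its integer powers are
written with the exponential, whose derivative is available for any exponent. *)
Definition frame_scale (R : realType) (d1 d2 : R) (k ell : int) (t : R) : R :=
  (2 / sin d1) ^ k * (2 * cos d2 / sin d2) ^ ell *
  expR (k%:~R * - ln (cos (angle1 d1 t)) + ell%:~R * - ln (cos (angle2 d2 t))).

Definition line_frame (R : realType) (d1 d2 : R) (k ell : int) (t : R) :
    'M[R[i]]_2 :=
  (frame_scale d1 d2 k ell t)%:C *: spin (phase d1 d2 k ell t).

Lemma straight_sqr (R : realType) (k ell : int) :
  straight R k ell * straight R k ell = 1.
Proof. by rewrite /straight -expfzMl mulrNN mulr1 exp1rz. Qed.

Lemma straight_step1 (R : realType) (k ell : int) :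
  straight R (k + 1) ell = 1 * straight R k ell.
Proof. by rewrite mul1r. Qed.

Lemma straight_step2 (R : realType) (k ell : int) :
  straight R k (ell + 1) = -1 * straight R k ell.
Proof. by rewrite /straight expfzDr ?oppr_eq0 ?oner_eq0// expr1z mulrC. Qed.

Lemma norm_straight (R : realType) (k ell : int) : `|straight R k ell| = 1.
Proof.
apply/eqP; rewrite -(@eqrXn2 _ 2)// ?ler01// expr1n -normrX expr2.
by rewrite straight_sqr normr1.
Qed.

Lemma lax_straight (R : realType) (d l : R) (e E : R[i]) :
    e * e = 1 -> E * E = 1 ->
  lax d E (e * E) E l =
  let K := (cot (d / 2))%:C + e * (tan (d / 2))%:C in
  mx2 K ('i%C * (l%:C - e / l%:C)) ('i%C * (l%:C - e / l%:C)) K.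
Proof.
move=> e1 E1; have e0 := sqr1_neq0 e1; have E0 := sqr1_neq0 E1.
have eV : e^-1 = e by apply: (mulfI e0); rewrite divff// e1.
rewrite /lax /=.
by rewrite (mulrCA E e E) E1 divff// !mulr1 invfM eV ![_ * e]mulrC.
Qed.

(** From [tan a = sinh t sin d1], the matrix
(2 / sin d1) (1 + i sinh t sin d1 sigma1) is the multiple by
2 / (sin d1 cos a) of exp(i a sigma1). *)
Lemma laxL_spin (R : realType) (d1 : R) (k ell : int) (t : R) :
    sin d1 != 0 ->
  laxL d1 (straight R) (straight R) k ell (expR t) =
  (2 / sin d1 * expR (- ln (cos (angle1 d1 t))))%:C *: spin (angle1 d1 t).
Proof.
move=> s0; have a0 := cos_atan_neq0 (sinh t * sin d1).
have e0 : expR t != 0 by rewrite gt_eqF// expR_gt0.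
have aK := atanK (sinh t * sin d1).
rewrite /laxL straight_step1 lax_straight ?mulr1 ?straight_sqr//=.
rewrite expR_ln_cos scale_spinE -/(angle1 d1 t).
rewrite /angle1 in a0 aK *; set a := atan _ in a0 aK *.
have sE : sin a = sinh t * sin d1 * cos a by rewrite -aK /tan mulfVK.
have -> : (cot (d1 / 2))%:C + 1 * (tan (d1 / 2))%:C =
    (2 / sin d1 * (cos a)^-1 * cos a)%:C :> R[i].
  by rewrite mul1r -rmorphD cotDtan_half// mulfVK.
have -> // : 'i%C * ((expR t)%:C - 1 / (expR t)%:C) =
    0 +i* (2 / sin d1 * (cos a)^-1 * sin a) :> R[i].
rewrite sE div1r -fmorphV !cE /sinh expRN; congr Complex; field;
  by rewrite ?s0 ?a0 ?e0.
Qed.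

Lemma laxM_spin (R : realType) (d2 : R) (k ell : int) (t : R) :
    sin d2 != 0 -> cos d2 != 0 ->
  laxM d2 (straight R) (straight R) k ell (expR t) =
  (2 * cos d2 / sin d2 * expR (- ln (cos (angle2 d2 t))))%:C *:
    spin (angle2 d2 t).
Proof.
move=> s0 c0; have a0 := cos_atan_neq0 (cosh t * tan d2).
have e0 : expR t != 0 by rewrite gt_eqF// expR_gt0.
have aK := atanK (cosh t * tan d2).
rewrite /laxM straight_step2 lax_straight ?mulrNN ?mulr1 ?straight_sqr//=.
rewrite expR_ln_cos scale_spinE.
rewrite /angle2 in a0 aK *; set a := atan _ in a0 aK *.
have sE : sin a = cosh t * tan d2 * cos a by rewrite -aK /tan mulfVK.
have -> : (cot (d2 / 2))%:C + -1 * (tan (d2 / 2))%:C =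
    (2 * cos d2 / sin d2 * (cos a)^-1 * cos a)%:C :> R[i].
  by rewrite mulN1r -rmorphB cotBtan_half// mulfVK.
have -> // : 'i%C * ((expR t)%:C - -1 / (expR t)%:C) =
    0 +i* (2 * cos d2 / sin d2 * (cos a)^-1 * sin a) :> R[i].
rewrite sE mulN1r opprK -fmorphV !cE /cosh /tan expRN; congr Complex; field;
  by rewrite ?s0 ?a0 ?e0 ?c0.
Qed.

Lemma frame_scale_step1 (R : realType) (d1 d2 : R) (k ell : int) (t : R) :
    sin d1 != 0 ->
  frame_scale d1 d2 (k + 1) ell t =
  2 / sin d1 * expR (- ln (cos (angle1 d1 t))) * frame_scale d1 d2 k ell t.
Proof.
move=> s0; rewrite /frame_scale.
rewrite expfzDr ?mulf_neq0 ?invr_eq0 ?pnatr_eq0// expr1z.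
by rewrite intrD (mulrDl k%:~R) mulr1z mul1r addrAC expRD; ring.
Qed.

Lemma frame_scale_step2 (R : realType) (d1 d2 : R) (k ell : int) (t : R) :
    sin d2 != 0 -> cos d2 != 0 ->
  frame_scale d1 d2 k (ell + 1) t =
  2 * cos d2 / sin d2 * expR (- ln (cos (angle2 d2 t))) *
    frame_scale d1 d2 k ell t.
Proof.
move=> s0 c0; rewrite /frame_scale.
rewrite expfzDr ?mulf_neq0 ?invr_eq0 ?pnatr_eq0// expr1z.
by rewrite intrD (mulrDl ell%:~R) mulr1z mul1r addrA expRD; ring.
Qed.

Lemma frame_scale_neq0 (R : realType) (d1 d2 : R) (k ell : int) (t : R) :
    sin d1 != 0 -> sin d2 != 0 -> cos d2 != 0 -> frame_scale d1 d2 k ell t != 0.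
Proof.
move=> s1 s2 c2; rewrite /frame_scale.
rewrite !mulf_neq0 ?expfz_neq0 ?mulf_neq0 ?invr_eq0 ?pnatr_eq0//.
by rewrite gt_eqF// expR_gt0.
Qed.

Lemma line_frameP (R : realType) (d1 d2 : R) :
    sin d1 != 0 -> sin d2 != 0 -> cos d2 != 0 ->
  is_straight_frame d1 d2 (line_frame d1 d2).
Proof.
move=> s1 s2 c2; split=> [k ell t|t]; last first.
  rewrite /line_frame /frame_scale /phase !mul0r !expr0z addr0 expR0 !mulr1.
  by rewrite spin0 scale1r.
rewrite laxL_spin// laxM_spin// /line_frame !scale_spinM.
rewrite -frame_scale_step1// -frame_scale_step2//.
by split; congr (_ *: spin _); rewrite /phase intrD; ring.
Qed.

Lemma line_frame_unique (R : realType) (d1 d2 : R) Phi Phi' :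
    sin d1 != 0 -> sin d2 != 0 -> cos d2 != 0 ->
    is_straight_frame d1 d2 Phi -> is_straight_frame d1 d2 Phi' ->
  Phi = Phi' :> (int -> int -> R -> 'M[R[i]]_2).
Proof.
move=> s1 s2 c2 [F F0] [F' F'0].
have Lu k ell t : laxL d1 (straight R) (straight R) k ell (expR t) \in unitmx.
  rewrite laxL_spin//; apply: scale_spin_unit; apply: mulf_neq0.
    by rewrite mulf_neq0 ?invr_eq0 ?pnatr_eq0.
  by rewrite gt_eqF// expR_gt0.
have Mu k ell t : laxM d2 (straight R) (straight R) k ell (expR t) \in unitmx.
  rewrite laxM_spin//; apply: scale_spin_unit; apply: mulf_neq0.
    by rewrite !mulf_neq0 ?invr_eq0 ?pnatr_eq0.
  by rewrite gt_eqF// expR_gt0.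
apply/funext => k; apply/funext => ell; apply/funext => t.
apply: (@int2_ind_step (fun k ell => Phi k ell t = Phi' k ell t)) k ell => /=.
- by rewrite F0 F'0.
- by move=> k ell h; rewrite (F k ell t).1 (F' k ell t).1 h.
- move=> k ell; rewrite (F k ell t).1 (F' k ell t).1.
  exact: (can_inj (mulKmx (Lu k ell t))).
- by move=> k ell h; rewrite (F k ell t).2 (F' k ell t).2 h.
- move=> k ell; rewrite (F k ell t).2 (F' k ell t).2.
  exact: (can_inj (mulKmx (Mu k ell t))).
Qed.

(** * The net of the straight line *)

Lemma is_derive_expN (R : realType) (t : R) :
  is_derive t 1 (fun u => expR (- u)) (- expR (- t)).
Proof.
apply: (is_derive_eq (is_derive_chain (is_derive_opp (is_derive_id t 1))
  (is_derive_expR _))).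
by rewrite mulrN1.
Qed.

Lemma is_derive_sinh (R : realType) (t : R) : is_derive t 1 (@sinh R) (cosh t).
Proof.
apply: (is_derive_eq (is_derive_mul
  (is_derive_sub (is_derive_expR t) (is_derive_expN t))
  (is_derive_const _ t))).
by rewrite mulr0 addr0 opprK.
Qed.

Lemma is_derive_cosh (R : realType) (t : R) : is_derive t 1 (@cosh R) (sinh t).
Proof.
apply: (is_derive_eq (is_derive_mul
  (is_derive_add (is_derive_expR t) (is_derive_expN t))
  (is_derive_const _ t))).
by rewrite mulr0 addr0.
Qed.

Lemma sqr_cosh (R : realType) (t : R) : cosh t ^+ 2 = 1 + sinh t ^+ 2.
Proof.
have e0 : expR t != 0 by rewrite gt_eqF// expR_gt0.
by rewrite /cosh /sinh expRN; field.
Qed.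

Lemma is_derive_angle1 (R : realType) (d1 t : R) :
  is_derive t 1 (angle1 d1)
    (cosh t * sin d1 / (1 + sinh t ^+ 2 * sin d1 ^+ 2)).
Proof.
apply: (is_derive_eq (is_derive_chain (is_derive_mul (is_derive_sinh t)
  (is_derive_const (sin d1) t)) (is_derive1_atan _))).
by rewrite mulr0 addr0 mulrC exprMn.
Qed.

Lemma is_derive_angle2 (R : realType) (d2 t : R) : cos d2 != 0 ->
  is_derive t 1 (angle2 d2)
    (sinh t * sin d2 * cos d2 / (1 + sinh t ^+ 2 * sin d2 ^+ 2)).
Proof.
move=> c0; apply: (is_derive_eq (is_derive_chain (is_derive_mul
  (is_derive_cosh t) (is_derive_const (tan d2) t)) (is_derive1_atan _))).
have -> : 1 + (cosh t * tan d2) ^+ 2 =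
    (1 + sinh t ^+ 2 * sin d2 ^+ 2) / cos d2 ^+ 2.
  transitivity ((cos d2 ^+ 2 + cosh t ^+ 2 * sin d2 ^+ 2) / cos d2 ^+ 2).
    by rewrite /tan; field.
  by congr (_ / _); rewrite sqr_cosh cos2sin2; ring.
by rewrite mulr0 addr0 /tan; field; rewrite sumsqr_neq0 c0.
Qed.

Lemma is_derive_phase (R : realType) (d1 d2 : R) (k ell : int) (t : R) :
    cos d2 != 0 ->
  is_derive t 1 (phase d1 d2 k ell) (xline d1 d2 k ell t).
Proof.
move=> c0; apply: (is_derive_eq (is_derive_add
  (is_derive_mul (is_derive_const _ t) (is_derive_angle1 d1 t))
  (is_derive_mul (is_derive_const _ t) (is_derive_angle2 t c0)))).
by rewrite !mul0r !add0r.
Qed.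

Lemma is_derive_frame_scale (R : realType) (d1 d2 : R) (k ell : int) (t : R) :
    cos d2 != 0 ->
  exists g', is_derive t 1 (frame_scale d1 d2 k ell) g'.
Proof.
move=> c0.
have dln f f' (df : is_derive t 1 f f') (f0 : 0 < cos (f t)) :=
  is_derive_opp (is_derive_chain (is_derive_chain df (is_derive_cos (f t)))
    (is_derive1_ln f0)).
eexists; apply: (is_derive_mul (is_derive_const _ t) (is_derive_chain
  (is_derive_add
    (is_derive_mul (is_derive_const _ t)
      (dln _ _ (is_derive_angle1 d1 t) (cos_atan_gt0 _)))
    (is_derive_mul (is_derive_const _ t)
      (dln _ _ (is_derive_angle2 t c0) (cos_atan_gt0 _))))
  (is_derive_expR _))).
Qed.

Lemma is_dmx_line_frame (R : realType) (d1 d2 : R) (k ell : int) (t : R) :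
    sin d1 != 0 -> sin d2 != 0 -> cos d2 != 0 ->
  exists F', is_dmx (line_frame d1 d2 k ell) t F'.
Proof.
move=> s1 s2 c2; have [g' dg] := is_derive_frame_scale d1 k ell t c2.
eexists; exact: (is_dmx_spin (frame_scale_neq0 k ell t s1 s2 c2) dg
  (is_derive_phase d1 k ell t c2)).
Qed.

Lemma net_f_line_frame (R : realType) (d1 d2 : R) (k ell : int) (t : R) :
    sin d1 != 0 -> sin d2 != 0 -> cos d2 != 0 ->
  net_f (line_frame d1 d2 k ell) t = imquat (f0 d1 d2 k ell t).
Proof.
move=> s1 s2 c2; have [g' dg] := is_derive_frame_scale d1 k ell t c2.
exact: (net_f_spin (frame_scale_neq0 k ell t s1 s2 c2) dg
  (is_derive_phase d1 k ell t c2)).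
Qed.

(** * The intertwining relation on one edge *)

(** The matrix U of the transformation, as a function of c = cot(alpha/2), of
the ratio r = s_b / s_0 and of the spectral parameter l. *)
Definition ratioU (R : realType) (c r l : R[i]) : 'M[R[i]]_2 :=
  mx2 (c * r) ('i%C * l) ('i%C * l) (c / r).

Lemma backU_ratio (R : realType) (alpha l : R) (s sb : int -> int -> R[i])
    (k ell : int) (r : R[i]) :
    s k ell != 0 -> sb k ell = s k ell * r ->
  backU alpha s sb k ell l = ratioU (cot (alpha / 2))%:C r l%:C.
Proof.
rewrite /backU /ratioU => s0 -> /=; rewrite [_ * r]mulrC mulfK//.
by rewrite invfM [_ / s k ell]mulrC mulVKf.
Qed.

(** The signs of the vertex and edge functions of the straight line cancel:
only the ratios of the new functions to the old ones remain. *)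
Lemma lax_ratio (R : realType) (d l : R) (e E r r' q : R[i]) :
    e * e = 1 -> E * E = 1 -> r != 0 -> r' != 0 -> q != 0 ->
  lax d (E * r) (e * E * r') (E * q) l =
  let C := (cot (d / 2))%:C in let T := (tan (d / 2))%:C in
  mx2 (q * (C / r + e * T * r')) ('i%C * (l%:C - e * (r * r') / l%:C))
      ('i%C * (l%:C - e / (l%:C * (r * r')))) (q^-1 * (C * r + e * T / r')).
Proof.
move=> e1 E1 r0 r'0 q0; have e0 := sqr1_neq0 e1; have E0 := sqr1_neq0 E1.
have eV : e^-1 = e by apply: (mulfI e0); rewrite divff// e1.
have EV : E^-1 = E by apply: (mulfI E0); rewrite divff// E1.
have X x y : E * x * (e * E * y) = e * (x * y).
  by rewrite mulrACA (mulrCA E) E1 mulr1.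
rewrite /lax /= !X !invfM eV EV.
congr mx2.
- by rewrite mulrACA E1 mul1r; ring.
- by congr ('i%C * (_ - _)); ring.
- by rewrite mulrACA E1 mul1r; ring.
Qed.

(** Entry by entry, the intertwining relation follows from the Moebius relation
between [r] and [r'] together with the equation for the edge variable [q] and
the complex conjugate of that equation, in which conjugates of unit numbers
are written as inverses. *)
Lemma intertwining_entries (F : fieldType) (i c C T e K r r' q l : F) :
    i * i = -1 -> r != 0 -> r' != 0 -> q != 0 -> l != 0 ->
    c * K * (r' - r) = (c ^+ 2 + e) * (r * r' - 1) ->
    q * (C + e * T * (r * r')) = c * (r * r' - 1) + K * r ->
    q^-1 * (C + e * T / (r * r')) = c * ((r * r')^-1 - 1) + K / r ->
  [/\ c * r' * K + i * l * (i * (l - e / l)) =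
      q * (C / r + e * T * r') * (c * r) +
        i * (l - e * (r * r') / l) * (i * l),
      c * r' * (i * (l - e / l)) + i * l * K =
      q * (C / r + e * T * r') * (i * l) +
        i * (l - e * (r * r') / l) * (c / r),
      i * l * K + c / r' * (i * (l - e / l)) =
      i * (l - e / (l * (r * r'))) * (c * r) +
        q^-1 * (C * r + e * T / r') * (i * l) &
      i * l * (i * (l - e / l)) + c / r' * K =
      i * (l - e / (l * (r * r'))) * (i * l) +
        q^-1 * (C * r + e * T / r') * (c / r)].
Proof.
move=> I r0 r'0 q0 l0 H H1 H2.
have E1 : q * (C / r + e * T * r') = (c * (r * r' - 1) + K * r) / r.
  by rewrite -H1; field; exact: r0.
have E2 : q^-1 * (C * r + e * T / r') = (c * ((r * r')^-1 - 1) + K / r) * r.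
  by rewrite -H2; field; rewrite ?r0 ?r'0 ?q0.
rewrite E1 E2 !(mulrACA i _ i) I.
split.
- transitivity (c * r' * K - l ^+ 2 + e); first by field.
  have -> : c * r' * K = c * K * (r' - r) + c * K * r by ring.
  by rewrite H; field; rewrite ?r0 ?l0.
- by field; rewrite ?r0 ?l0.
- by field; rewrite ?r0 ?r'0 ?l0.
- have -> : c / r' * K = c * K * r / (r * r') by field; rewrite ?r0 ?r'0.
  have -> : c * K * r = c * K * r' - (c ^+ 2 + e) * (r * r' - 1).
    by rewrite -H; ring.
  by field; rewrite ?r0 ?r'0 ?l0.
Qed.

Lemma intertwining (R : realType) (c C T e K r r' q l : R[i]) :
    r != 0 -> r' != 0 -> q != 0 -> l != 0 ->
    c * K * (r' - r) = (c ^+ 2 + e) * (r * r' - 1) ->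
    q * (C + e * T * (r * r')) = c * (r * r' - 1) + K * r ->
    q^-1 * (C + e * T / (r * r')) = c * ((r * r')^-1 - 1) + K / r ->
  ratioU c r' l *m mx2 K ('i%C * (l - e / l)) ('i%C * (l - e / l)) K =
  mx2 (q * (C / r + e * T * r')) ('i%C * (l - e * (r * r') / l))
      ('i%C * (l - e / (l * (r * r')))) (q^-1 * (C * r + e * T / r')) *m
  ratioU c r l.
Proof.
move=> r0 r'0 q0 l0 H H1 H2.
have [E1 E2 E3 E4] := intertwining_entries (@sqr_im R) r0 r'0 q0 l0 H H1 H2.
by rewrite /ratioU !mx2_mul E1 E2 E3 E4.
Qed.

(** Conversely, the first row alone gives the Moebius relation: its second
entry determines [q], and substituting it in the first entry eliminates [q].
The relation does not contain [l], so one value of the spectral parameter is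
enough. *)
Lemma mobius_necessary (F : fieldType) (i c C T e K r r' q l : F) :
    i * i = -1 -> r != 0 -> l != 0 ->
    c * r' * K + i * l * (i * (l - e / l)) =
      q * (C / r + e * T * r') * (c * r) +
        i * (l - e * (r * r') / l) * (i * l) ->
    c * r' * (i * (l - e / l)) + i * l * K =
      q * (C / r + e * T * r') * (i * l) +
        i * (l - e * (r * r') / l) * (c / r) ->
  c * K * (r' - r) = (c ^+ 2 + e) * (r * r' - 1).
Proof.
move=> I r0 l0 H1 H2.
have i0 : i != 0.
  by apply/eqP => i0; move/eqP: I; rewrite i0 mul0r eq_sym oppr_eq0 oner_eq0.
set A := q * (C / r + e * T * r') in H1 H2.
have {H2} A2 : A = c * r' + K - c / r.
  apply: (mulIf (mulf_neq0 i0 l0)); apply/eqP; rewrite -subr_eq0; apply/eqP.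
  move: (esym H2) => /eqP; rewrite -subr_eq0 => /eqP <-.
  by field; rewrite ?l0 ?r0.
move: H1; rewrite !(mulrACA i _ i) I A2 => /eqP.
rewrite -subr_eq0 => /eqP H; apply/eqP; rewrite -subr_eq0; apply/eqP.
by rewrite -H; field; rewrite ?l0 ?r0.
Qed.

Lemma backlund_edge_necessary (R : realType) (alpha d e l : R)
    (E r r' q : R[i]) :
  let c := cot (alpha / 2) in let K := cot (d / 2) + e * tan (d / 2) in
    e ^+ 2 = 1 -> E * E = 1 -> r != 0 -> r' != 0 -> q != 0 -> l != 0 ->
    ratioU c%:C r' l%:C *m lax d E (e%:C * E) E l =
    lax d (E * r) (e%:C * E * r') (E * q) l *m ratioU c%:C r l%:C ->
  (c * K)%:C * (r' - r) = (c ^+ 2 + e)%:C * (r * r' - 1).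
Proof.
move=> c K e2 E1 r0 r'0 q0 l0.
have e1 : e%:C * e%:C = 1 :> R[i] by rewrite -rmorphM -expr2 e2.
have lC : l%:C != 0 :> R[i] by rewrite eq_complex /= eqxx andbT.
rewrite lax_straight// lax_ratio// /ratioU /= !mx2_mul => /mx2_eq[H1 H2 _ _].
have := mobius_necessary (@sqr_im R) r0 lC H1 H2.
have -> : c%:C * ((cot (d / 2))%:C + e%:C * (tan (d / 2))%:C) =
    (c * K)%:C :> R[i].
  by rewrite -rmorphM -rmorphD -rmorphM.
have -> // : c%:C ^+ 2 + e%:C = (c ^+ 2 + e)%:C :> R[i].
by rewrite -rmorphXn -rmorphD.
Qed.

(** For fixed [r], the relation is affine in [r'] with leading coefficient
[a - b r], which vanishes only if [a] and [b] have the same modulus. *)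
Lemma mobius_inj (R : realType) (a b : R) (r r' r'' : R[i]) :
    a ^+ 2 != b ^+ 2 -> `|r| = 1 ->
    a%:C * (r' - r) = b%:C * (r * r' - 1) ->
    a%:C * (r'' - r) = b%:C * (r * r'' - 1) -> r' = r''.
Proof.
move=> ab r1 H H'.
have : (a%:C - b%:C * r) * (r' - r'') = 0.
  have -> : (a%:C - b%:C * r) * (r' - r'') =
    (a%:C * (r' - r) - b%:C * (r * r' - 1)) -
    (a%:C * (r'' - r) - b%:C * (r * r'' - 1)) by ring.
  by rewrite H H' !subrr.
move/eqP; rewrite mulf_eq0 subr_eq0 => /orP[|].
  2: by rewrite subr_eq0 => /eqP.
move=> /eqP /(congr1 (fun z => `|z| ^+ 2)) /eqP.
rewrite normrM r1 mulr1 -!add_Re2_Im2 /= expr0n /= !addr0.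
by rewrite (inj_eq (@complexI R)) (negPf ab).
Qed.

(** * Cayley coordinates of the unit circle *)

Definition cay (R : realType) (u : R) : R[i] :=
  (1 + 'i%C * u%:C) / (1 - 'i%C * u%:C).

Lemma complex_neq0_Re (R : realType) (a b : R) :
  a != 0 -> a%:C + 'i%C * b%:C != 0.
Proof.
by move=> a0; rewrite eq_complex /= negb_and; simpc; rewrite a0.
Qed.

Lemma cay_den_neq0 (R : realType) (u : R) : 1 - 'i%C * u%:C != 0.
Proof.
by have := complex_neq0_Re (- u) (@oner_neq0 R); rewrite rmorphN rmorph1 mulrN.
Qed.

Lemma cayE (R : realType) (u : R) :
  cay u = ((1 - u ^+ 2) / (1 + u ^+ 2)) +i* (2 * u / (1 + u ^+ 2)).
Proof.
have u0 := sumsqr_neq0 u.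
apply: (canLR (mulfK (cay_den_neq0 u))); apply/eqP; rewrite eq_complex /=.
by apply/andP; split; apply/eqP; simpc; field.
Qed.

Lemma normc_eq1 (R : realType) (a b : R) :
  a ^+ 2 + b ^+ 2 = 1 -> `|a +i* b| = 1 :> R[i].
Proof. by move=> h; rewrite normc_def /= h sqrtr1. Qed.

Lemma cay_unit (R : realType) (u : R) : `|cay u| = 1.
Proof.
by rewrite cayE; apply: normc_eq1; have u0 := sumsqr_neq0 u; field.
Qed.

Lemma cay_tan_half (R : realType) (theta : R) :
  cos (theta / 2) != 0 -> cay (tan (theta / 2)) = cos theta +i* sin theta.
Proof.
move=> c0; rewrite cayE (cos_double_half theta) (sin_double_half theta) /tan.
have h := cos2Dsin2 (theta / 2).
set c := cos (theta / 2) in c0 h *; set s := sin (theta / 2) in h *.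
have -> : 1 + (s / c) ^+ 2 = c ^- 2.
  transitivity ((c ^+ 2 + s ^+ 2) / c ^+ 2); first by field.
  by rewrite h mul1r.
by apply/eqP; rewrite eq_complex /=; apply/andP; split; apply/eqP; field.
Qed.

(** The equation for the edge variable reads [q D = N], where [D] and [N] are
its two sides multiplied by (1 - i u) (1 - i v); this is [N]. *)
Definition edge_num (F : fieldType) (i c K u v : F) : F :=
  c * ((1 + i * u) * (1 + i * v) - (1 - i * u) * (1 - i * v)) +
  K * ((1 + i * u) * (1 - i * v)).

Definition edge_den (F : fieldType) (i C T e u v : F) : F :=
  C * ((1 - i * u) * (1 - i * v)) + e * T * ((1 + i * u) * (1 + i * v)).

(** In Cayley coordinates [r' - r] and [r r' - 1] are [v - u] and [u + v] times
a common factor, so the Moebius relation becomes linear in [v]. *)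
Lemma edge_equation (F : fieldType) (i c C T e K u v : F) :
    1 - i * u != 0 -> 1 - i * v != 0 -> edge_den i C T e u v != 0 ->
    c * K * (v - u) = (c ^+ 2 + e) * (u + v) ->
  let r := (1 + i * u) / (1 - i * u) in
  let r' := (1 + i * v) / (1 - i * v) in
  c * K * (r' - r) = (c ^+ 2 + e) * (r * r' - 1) /\
  edge_num i c K u v / edge_den i C T e u v * (C + e * T * (r * r')) =
    c * (r * r' - 1) + K * r.
Proof.
move=> u0 v0 d0 H r r'; split; last first.
  rewrite /r /r' /edge_num; move: d0; rewrite /edge_den => d0.
  by field; rewrite u0 v0 d0.
have -> : r' - r = 2 * i / ((1 - i * u) * (1 - i * v)) * (v - u).
  by rewrite /r /r'; field; rewrite u0 v0.
rewrite mulrCA H.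
by rewrite /r /r'; field; rewrite u0 v0.
Qed.

(** Both squared moduli equal
[K^2 (1 + u^2) (1 + v^2) - 4 e (u + v)^2]: for [D] because
[(C - e T)^2 = K^2 - 4 e], for [N] by the relation between [u] and [v].  If they
vanished, the real parts would give [u v = 1] and [u v = -1] at once. *)
Lemma edge_unit (R : realType) (c C T e K u v : R) :
    C * T = 1 -> K = C + e * T -> e ^+ 2 = 1 -> K != 0 ->
    c * K * (v - u) = (c ^+ 2 + e) * (u + v) ->
  let N := edge_num 'i%C c%:C K%:C u%:C v%:C in
  let D := edge_den 'i%C C%:C T%:C e%:C u%:C v%:C in
  D != 0 /\ `|N / D| = 1.
Proof.
move=> CT KE e2 K0 H N D.
have DE : D = (K * (1 - u * v)) +i* (- ((C - e * T) * (u + v))).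
  rewrite /D /edge_den; apply/eqP; rewrite eq_complex /= KE.
  by apply/andP; split; apply/eqP; simpc; ring.
have NE : N = (K * (1 + u * v)) +i* (2 * c * (u + v) + K * (u - v)).
  rewrite /N /edge_num; apply/eqP; rewrite eq_complex /=.
  by apply/andP; split; apply/eqP; simpc; ring.
have DN : `|N| = `|D|.
  rewrite NE DE !normc_def /=; congr (Num.sqrt _)%:C.
  have -> : (- ((C - e * T) * (u + v))) ^+ 2 =
    (K ^+ 2 - 4 * e * (C * T)) * (u + v) ^+ 2 by rewrite KE; ring.
  rewrite CT.
  transitivity ((K * (1 + u * v)) ^+ 2 + 4 * c ^+ 2 * (u + v) ^+ 2
      + (K * (u - v)) ^+ 2 - 4 * (u + v) * (c * K * (v - u))); first by ring.
  by rewrite H; ring.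
have D0 : D != 0.
  apply/eqP => D0; move: DN; rewrite D0 normr0 => /eqP; rewrite normr_eq0.
  move: D0; rewrite DE NE => -[/eqP + _].
  rewrite mulf_eq0 (negPf K0) /= subr_eq0 => /eqP uv1.
  rewrite -uv1 eq_complex /= mulf_eq0 (negPf K0) /=.
  by rewrite (_ : 1 + 1 = 2 :> R)// pnatr_eq0.
by split=> //; rewrite normf_div DN divff// normr_eq0.
Qed.

Lemma edge_relation_complex (R : realType) (c K e u v : R) :
    c * K * (v - u) = (c ^+ 2 + e) * (u + v) ->
  c%:C * K%:C * (v%:C - u%:C) = (c%:C ^+ 2 + e%:C) * (u%:C + v%:C) :> R[i].
Proof.
move/(congr1 (real_complex R)).
by rewrite expr2 !(rmorphM, rmorphD, rmorphN).
Qed.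

Lemma edge_equation_conj (R : realType) (c C T e K : R) (q r r' : R[i]) :
    `|q| = 1 -> `|r| = 1 -> `|r'| = 1 ->
    q * (C%:C + e%:C * T%:C * (r * r')) = c%:C * (r * r' - 1) + K%:C * r ->
  q^-1 * (C%:C + e%:C * T%:C / (r * r')) =
    c%:C * ((r * r')^-1 - 1) + K%:C / r.
Proof.
move=> q1 u1 v1 /(congr1 (@conjc R)).
rewrite !(rmorphM, rmorphD, rmorphN, rmorph1) /=.
rewrite !(unit_conj q1, unit_conj u1, unit_conj v1, conjc_real).
by rewrite invfM oppr0.
Qed.

Definition edge (R : realType) (alpha d e u v : R) : R[i] :=
  edge_num 'i%C (cot (alpha / 2))%:C (cot (d / 2) + e * tan (d / 2))%:C
    u%:C v%:C /
  edge_den 'i%C (cot (d / 2))%:C (tan (d / 2))%:C e%:C u%:C v%:C.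

Lemma backlund_edge (R : realType) (alpha d e u v l : R) (E : R[i]) :
  let c := cot (alpha / 2) in let C := cot (d / 2) in let T := tan (d / 2) in
  let K := C + e * T in let q := edge alpha d e u v in
    C * T = 1 -> e ^+ 2 = 1 -> K != 0 -> 0 < l -> E * E = 1 ->
    c * K * (v - u) = (c ^+ 2 + e) * (u + v) ->
  `|q| = 1 /\
  ratioU c%:C (cay v) l%:C *m lax d E (e%:C * E) E l =
  lax d (E * cay u) (e%:C * E * cay v) (E * q) l *m ratioU c%:C (cay u) l%:C.
Proof.
move=> c C T K q CT e2 K0 l0 E2 H.
have [D0 q1] := edge_unit CT (erefl K) e2 K0 H.
rewrite -/(edge alpha d e u v) -/q in q1; split=> //.
have e1 : e%:C * e%:C = 1 :> R[i] by rewrite -rmorphM -expr2 e2.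
have u1 := cay_unit u; have v1 := cay_unit v.
have [u0 v0 q0] := And3 (unit_neq0 u1) (unit_neq0 v1) (unit_neq0 q1).
have [H1 H2] :=
  edge_equation (cay_den_neq0 u) (cay_den_neq0 v) D0 (edge_relation_complex H).
rewrite lax_straight// lax_ratio//.
have KE : (cot (d / 2))%:C + e%:C * (tan (d / 2))%:C = K%:C :> R[i].
  by rewrite -rmorphM -rmorphD.
rewrite /= KE; apply: intertwining => //.
  by rewrite (eq_complex l%:C) /= eqxx andbT gt_eqF.
exact: edge_equation_conj.
Qed.

(** * The transformed vertex function *)

(** Up to a nonzero square, the difference of the two sides is
[sin^2 alpha - sin^2 d1]. *)
Lemma nondegenerate_step1 (R : realType) (d1 alpha : R)
    (sa0 : sin alpha != 0)
    (sd1 : sin d1 != 0)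
    (alpha_d1_minus : sin alpha != sin d1)
    (alpha_d1_plus : sin alpha != - sin d1) :
  (cot (alpha / 2) * (cot (d1 / 2) + 1 * tan (d1 / 2))) ^+ 2 !=
  (cot (alpha / 2) ^+ 2 + 1) ^+ 2.
Proof.
rewrite mul1r cotDtan_half// sqr_cot_halfD1//.
have [s0 c0] := half_neq0 sa0.
have c1 : cot (alpha / 2) != 0 by rewrite /cot mulf_neq0// invr_eq0.
rewrite -subr_eq0.
have -> : (cot (alpha / 2) * (2 / sin d1)) ^+ 2 -
  (2 * cot (alpha / 2) / sin alpha) ^+ 2 =
  (2 * cot (alpha / 2) / (sin d1 * sin alpha)) ^+ 2 *
    ((sin alpha - sin d1) * (sin alpha + sin d1)).
  by field; rewrite sa0 sd1.
by rewrite mulf_neq0 ?expf_neq0 ?mulf_neq0 ?invr_eq0 ?mulf_neq0 ?pnatr_eq0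
  ?subr_eq0 ?addr_eq0.
Qed.

(** Up to a nonzero square, the difference of the two sides is
[sin (alpha - d2) sin (alpha + d2)]. *)
Lemma nondegenerate_step2 (R : realType) (d2 alpha : R)
    (sa0 : sin alpha != 0)
    (sincos_d2 : sin d2 * cos d2 != 0)
    (alpha_d2_plus : sin (alpha + d2) != 0)
    (alpha_d2_minus : sin (alpha - d2) != 0) :
  (cot (alpha / 2) * (cot (d2 / 2) + -1 * tan (d2 / 2))) ^+ 2 !=
  (cot (alpha / 2) ^+ 2 + -1) ^+ 2.
Proof.
move: sincos_d2; rewrite mulf_eq0 negb_or => /andP[sd2 cd2].
rewrite mulN1r cotBtan_half// sqr_cot_halfB1//.
have [s0 c0] := half_neq0 sa0.
have c1 : cot (alpha / 2) != 0 by rewrite /cot mulf_neq0// invr_eq0.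
rewrite -subr_eq0.
have -> : (cot (alpha / 2) * (2 * cos d2 / sin d2)) ^+ 2 -
  (2 * cot (alpha / 2) * cos alpha / sin alpha) ^+ 2 =
  (2 * cot (alpha / 2) / (sin d2 * sin alpha)) ^+ 2 *
    (sin (alpha - d2) * sin (alpha + d2)).
  by rewrite sinB sinD; field; rewrite sa0 sd2.
by rewrite mulf_neq0 ?expf_neq0 ?mulf_neq0 ?invr_eq0 ?mulf_neq0 ?pnatr_eq0.
Qed.

(** Half-angle formulas turn [c K] and [c^2 + e] into multiples of
[1 / sin d1] and [1 / sin alpha], so the linear relation says that [u] is
multiplied by the factor that [expchi] acquires from [k] to [k + 1]. *)
Lemma expchi_step1 (R : realType) (d1 d2 alpha theta : R) (k ell : int)
    (sa0 : sin alpha != 0)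
    (sd1 : sin d1 != 0)
    (alpha_d1_minus : sin alpha != sin d1)
    (alpha_d1_plus : sin alpha != - sin d1) :
  let u := expchi d1 d2 alpha theta k ell in
  let v := expchi d1 d2 alpha theta (k + 1) ell in
  cot (alpha / 2) * (cot (d1 / 2) + 1 * tan (d1 / 2)) * (v - u) =
  (cot (alpha / 2) ^+ 2 + 1) * (u + v).
Proof.
move=> u v.
have m0 : sin alpha - sin d1 != 0 by rewrite subr_eq0.
have p0 : sin alpha + sin d1 != 0 by rewrite addr_eq0.
have -> : v = u * ((sin alpha + sin d1) / (sin alpha - sin d1)).
  rewrite /v /expchi expfzDr ?expr1z; last by rewrite mulf_neq0// invr_eq0.
  by rewrite /u /expchi; ring.
rewrite mul1r cotDtan_half// sqr_cot_halfD1//; field.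
by rewrite sd1 sa0 m0.
Qed.

Lemma expchi_step2 (R : realType) (d1 d2 alpha theta : R) (k ell : int)
    (sa0 : sin alpha != 0)
    (sincos_d2 : sin d2 * cos d2 != 0)
    (alpha_d2_plus : sin (alpha + d2) != 0)
    (alpha_d2_minus : sin (alpha - d2) != 0) :
  let u := expchi d1 d2 alpha theta k ell in
  let v := expchi d1 d2 alpha theta k (ell + 1) in
  cot (alpha / 2) * (cot (d2 / 2) + -1 * tan (d2 / 2)) * (v - u) =
  (cot (alpha / 2) ^+ 2 + -1) * (u + v).
Proof.
move=> u v.
move: sincos_d2; rewrite mulf_eq0 negb_or => /andP[sd2 cd2].
have g0 : sin (alpha - d2) / sin (alpha + d2) != 0.
  by rewrite mulf_neq0// invr_eq0.
have -> : v = u * (sin (alpha + d2) / sin (alpha - d2)).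
  by rewrite /v /expchi opprD expfzDr// exprN1 invf_div [LHS]mulrA.
move: alpha_d2_minus alpha_d2_plus; rewrite sinB sinD => m0 p0.
rewrite mulN1r cotBtan_half// sqr_cot_halfB1//; field.
by rewrite sd2 sa0 m0.
Qed.

Lemma expchi_neq0 (R : realType) (d1 d2 alpha theta : R) (k ell : int) :
    tan (theta / 2) != 0 -> sin alpha != sin d1 -> sin alpha != - sin d1 ->
    sin (alpha + d2) != 0 -> sin (alpha - d2) != 0 ->
  expchi d1 d2 alpha theta k ell != 0.
Proof.
move=> t0 m1 p1 p2 m2; rewrite /expchi; apply: mulf_neq0.
  apply: mulf_neq0 t0 _.
  by rewrite expfz_neq0// mulf_neq0 ?invr_eq0 ?subr_eq0 ?addr_eq0.
by rewrite expfz_neq0// mulf_neq0 ?invr_eq0.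
Qed.

Definition line_backlund (R : realType) (d1 d2 alpha theta : R)
    (k ell : int) : R[i] :=
  straight R k ell * cay (expchi d1 d2 alpha theta k ell).

Lemma line_backlundP (R : realType) (d1 d2 alpha theta : R)
    (sa0 : sin alpha != 0)
    (sd1 : sin d1 != 0)
    (sincos_d2 : sin d2 * cos d2 != 0)
    (alpha_d1_minus : sin alpha != sin d1)
    (alpha_d1_plus : sin alpha != - sin d1)
    (alpha_d2_plus : sin (alpha + d2) != 0)
    (alpha_d2_minus : sin (alpha - d2) != 0) :
    cos (theta / 2) != 0 ->
  is_straight_backlund d1 d2 alpha theta (line_backlund d1 d2 alpha theta).
Proof.
move=> ct0.
pose u := expchi d1 d2 alpha theta.
pose lt k ell := straight R k ell * edge alpha d1 1 (u k ell) (u (k + 1) ell).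
pose mt k ell :=
  straight R k ell * edge alpha d2 (-1) (u k ell) (u k (ell + 1)).
have s0 k ell : straight R k ell != 0 := sqr1_neq0 (straight_sqr R k ell).
move: (sincos_d2); rewrite mulf_eq0 negb_or => /andP[sd2 cd2].
have K1 : cot (d1 / 2) + 1 * tan (d1 / 2) != 0.
  by rewrite mul1r cotDtan_half// mulf_neq0 ?invr_eq0 ?pnatr_eq0.
have K2 : cot (d2 / 2) + -1 * tan (d2 / 2) != 0.
  by rewrite mulN1r cotBtan_half// !mulf_neq0 ?invr_eq0 ?pnatr_eq0.
have downP k ell l (l0 : 0 < l) :=
  backlund_edge (cot_half_tan_half sd1) (expr1n _ 2) K1 l0
    (straight_sqr R k ell)
    (expchi_step1 d2 theta k ell sa0 sd1 alpha_d1_minus alpha_d1_plus).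
have e2 : (-1) ^+ 2 = 1 :> R by rewrite sqrrN expr1n.
have rightP k ell l (l0 : 0 < l) :=
  backlund_edge (cot_half_tan_half sd2) e2 K2 l0
    (straight_sqr R k ell)
    (expchi_step2 d1 theta k ell sa0 sincos_d2 alpha_d2_plus alpha_d2_minus).
split.
- rewrite /line_backlund /straight expr0z mul1r /expchi oppr0 !expr0z !mulr1.
  exact: cay_tan_half.
- by move=> k ell; rewrite /line_backlund normrM norm_straight cay_unit mulr1.
exists lt, mt; split=> [k ell|k ell l l0].
  have [q1 _] := downP k ell 1 ltr01; have [q1' _] := rightP k ell 1 ltr01.
  by split; rewrite normrM norm_straight mul1r.
have [_] := downP k ell l l0; have [_] := rightP k ell l l0.
rewrite !(rmorphN, rmorph1) -straight_step2 -straight_step1 => right down.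
rewrite /laxL /laxM.
by split; rewrite !(backU_ratio _ _ (s0 _ _)
  (erefl (line_backlund d1 d2 alpha theta _ _))).
Qed.

(** The ratios of two solutions to the straight line obey the same Moebius
relations, which can be solved in both directions along every edge, and they
agree at the origin. *)
Lemma line_backlund_unique (R : realType) (d1 d2 alpha theta : R)
    (sb sb' : int -> int -> R[i]) :
    sin alpha != 0 -> sin d1 != 0 -> sin d2 * cos d2 != 0 ->
    sin alpha != sin d1 -> sin alpha != - sin d1 ->
    sin (alpha + d2) != 0 -> sin (alpha - d2) != 0 ->
    is_straight_backlund d1 d2 alpha theta sb ->
    is_straight_backlund d1 d2 alpha theta sb' ->
  sb = sb'.
Proof.
move=> sa0 sd1 sd2 am1 ap1 ap2 am2.
pose c := cot (alpha / 2).
pose K1 := cot (d1 / 2) + 1 * tan (d1 / 2).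
pose K2 := cot (d2 / 2) + -1 * tan (d2 / 2).
pose rel a b (r r' : R[i]) := a%:C * (r' - r) = b%:C * (r * r' - 1).
have s0 k ell : straight R k ell != 0 := sqr1_neq0 (straight_sqr R k ell).
have ratio s : is_straight_backlund d1 d2 alpha theta s ->
  exists r : int -> int -> R[i],
    [/\ forall k ell, s k ell = straight R k ell * r k ell,
        forall k ell, `|r k ell| = 1,
        forall k ell, rel (c * K1) (c ^+ 2 + 1) (r k ell) (r (k + 1) ell) &
        forall k ell, rel (c * K2) (c ^+ 2 + -1) (r k ell) (r k (ell + 1))].
  case=> _ s1 [lt [mt [lm1 H]]]; pose r k ell := s k ell / straight R k ell.
  have sr k ell : s k ell = straight R k ell * r k ell.
    by rewrite /r mulrC divfK.
  have r1 k ell : `|r k ell| = 1.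
    by rewrite /r normf_div s1 norm_straight divr1.
  pose l' k ell := lt k ell / straight R k ell.
  pose m' k ell := mt k ell / straight R k ell.
  have lr k ell : lt k ell = straight R k ell * l' k ell.
    by rewrite /l' mulrC divfK.
  have mr k ell : mt k ell = straight R k ell * m' k ell.
    by rewrite /m' mulrC divfK.
  have l0 k ell : l' k ell != 0.
    by rewrite mulf_neq0 ?invr_eq0// unit_neq0// (lm1 _ _).1.
  have m0 k ell : m' k ell != 0.
    by rewrite mulf_neq0 ?invr_eq0// unit_neq0// (lm1 _ _).2.
  exists r; split=> // k ell; have [down right] := H k ell 1 ltr01.
    (* The relation does not contain the spectral parameter: 1 is enough. *)
    apply: (backlund_edge_necessary (expr1n _ 2) (straight_sqr R k ell)
      (unit_neq0 (r1 _ _)) (unit_neq0 (r1 _ _)) (l0 k ell) (oner_neq0 R)).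
    move: down; rewrite !(backU_ratio _ _ (s0 _ _) (sr _ _)) /laxL !sr lr.
    by rewrite straight_step1.
  have e2 : (-1) ^+ 2 = 1 :> R by rewrite sqrrN expr1n.
  apply: (backlund_edge_necessary e2 (straight_sqr R k ell)
      (unit_neq0 (r1 _ _)) (unit_neq0 (r1 _ _)) (m0 k ell) (oner_neq0 R)).
  move: right; rewrite !(backU_ratio _ _ (s0 _ _) (sr _ _)) /laxM !sr mr.
  by rewrite straight_step2 rmorphN rmorph1.
have D1 := nondegenerate_step1 sa0 sd1 am1 ap1.
have D2 := nondegenerate_step2 sa0 sd2 ap2 am2.
(* Backward steps: the relation read from r' to r is of the same type. *)
have relV a b r r' : rel a b r r' -> rel a (- b) r' r.
  by rewrite /rel => h; rewrite rmorphN mulNr [r' * r]mulrC -h; ring.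
move=> B B'; have [r [sr r1 rd rr]] := ratio _ B.
have [r' [sr' r1' rd' rr']] := ratio _ B'.
suff rE k ell : r k ell = r' k ell.
  by apply/funext => k; apply/funext => ell; rewrite sr sr' rE.
apply: (@int2_ind_step (fun k ell => r k ell = r' k ell)) k ell => /=.
- by apply: (mulfI (s0 0 0)); rewrite -sr -sr'; case: B B' => -> _ _ [-> _ _].
- move=> k ell h; apply: (mobius_inj D1 (r1 k ell) (rd k ell)).
  by rewrite h; exact: rd'.
- move=> k ell h.
  apply: (mobius_inj _ (r1 (k + 1) ell) (relV _ _ _ _ (rd k ell))).
    by rewrite sqrrN.
  by rewrite h; apply: relV; exact: rd'.
- move=> k ell h; apply: (mobius_inj D2 (r1 k ell) (rr k ell)).
  by rewrite h; exact: rr'.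
- move=> k ell h.
  apply: (mobius_inj _ (r1 k (ell + 1)) (relV _ _ _ _ (rr k ell))).
    by rewrite sqrrN.
  by rewrite h; apply: relV; exact: rr'.
Qed.

(** * The net of the transformation matrix *)

Lemma add_inv_mul (R : realType) (u : R) : u != 0 ->
  (u + u^-1) * u = 1 + u ^+ 2.
Proof. by move=> u0; rewrite mulrDl mulVf// addrC -expr2. Qed.

Lemma tanh_expE (R : realType) (u : R) : u != 0 ->
  tanh_exp u = - ((1 - u ^+ 2) / (1 + u ^+ 2)).
Proof.
move=> u0; transitivity ((u - u^-1) * u / ((u + u^-1) * u)).
  by rewrite -mulf_div divff// mulr1.
rewrite add_inv_mul// -mulNr opprB; congr (_ / _).
by rewrite mulrBl mulVf// -expr2.
Qed.

Lemma sech_expE (R : realType) (u : R) : u != 0 ->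
  sech_exp u = 2 * u / (1 + u ^+ 2).
Proof.
move=> u0; rewrite -add_inv_mul//.
by rewrite -mulf_div divff// mulr1.
Qed.

Lemma tanh_sech (R : realType) (u : R) : u != 0 ->
  (- tanh_exp u) ^+ 2 + sech_exp u ^+ 2 = 1.
Proof.
move=> u0; rewrite tanh_expE// sech_expE//; have D0 := sumsqr_neq0 u.
by field.
Qed.

(** The cosine and sine of an angle [b] with [tan (b / 2) = e^chi] are
[- tanh chi] and [sech chi]: this is how the hyperbolic functions of [chi]
enter. *)
Lemma cay_exp (R : realType) (u : R) : u != 0 ->
  cay u = (- tanh_exp u) +i* sech_exp u.
Proof. by move=> u0; rewrite cayE tanh_expE// sech_expE// opprK. Qed.

(** The matrix U with the ratio s_b / s_0 written as [p + i q]; its parameters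
are real, which is the form in which it is differentiated. *)
Definition darboux (R : realType) (c p q l : R) : 'M[R[i]]_2 :=
  mx2 ((c * p) +i* (c * q)) (0 +i* l) (0 +i* l) ((c * p) -i* (c * q)).

Lemma darboux_inv (R : realType) (c p q l : R) :
    p ^+ 2 + q ^+ 2 = 1 -> l != 0 ->
  darboux c p q l \in unitmx /\
  invmx (darboux c p q l) = (c ^+ 2 + l ^+ 2)^-1%:C *:
    mx2 ((c * p) -i* (c * q)) (0 -i* l) (0 -i* l) ((c * p) +i* (c * q)).
Proof.
move=> pq l0.
have D : ((c * p) +i* (c * q)) * ((c * p) -i* (c * q)) -
    (0 +i* l) * (0 +i* l) = (c ^+ 2 + l ^+ 2)%:C :> R[i].
  rewrite !cE; congr Complex; last by ring.
  transitivity (c ^+ 2 * (p ^+ 2 + q ^+ 2) + l ^+ 2); first by ring.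
  by rewrite pq mulr1.
have D0 : c ^+ 2 + l ^+ 2 != 0.
  by rewrite gt_eqF// ltr_wpDl ?sqr_ge0// exprn_even_gt0.
have := @mx2_inv R ((c * p) +i* (c * q)) (0 +i* l) (0 +i* l)
  ((c * p) -i* (c * q)).
rewrite D eq_complex /= eqxx andbT => /(_ D0)[U V].
rewrite /darboux; split=> //; rewrite V.
by rewrite oppcE oppr0 -fmorphV.
Qed.

Lemma is_dmx_darboux (R : realType) (c p q t : R) :
  is_dmx (fun u => darboux c p q (expR u)) t
    (mx2 0 (0 +i* expR t) (0 +i* expR t) 0).
Proof.
by apply: is_dmx_mx2; split;
  first [exact: is_derive_const | exact: is_derive_expR].
Qed.

Lemma net_f_darboux (R : realType) (c p q t : R) :
    p ^+ 2 + q ^+ 2 = 1 ->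
  net_f (fun u => darboux c p q (expR u)) t =
  imquat (2 * c * expR t / (c ^+ 2 + expR t ^+ 2) *: vec3 (- p) (- q) 0).
Proof.
move=> pq; set l := expR t; have l0 : l != 0 by rewrite gt_eqF// expR_gt0.
have D0 : c ^+ 2 + l ^+ 2 != 0.
  by rewrite gt_eqF// ltr_wpDl ?sqr_ge0// exprn_even_gt0.
have [_ UV] := darboux_inv c pq l0.
rewrite /net_f (is_dmxE (is_dmx_darboux c p q t)) UV -/l.
rewrite -scalemxAl mx2_mul mx2_scale.
rewrite trfree_mx2 mx2_scale vec3_scale imquat_vec3.
have h2 : 2^-1 = (2^-1 : R)%:C :> R[i] by rewrite fmorphV rmorph_nat.
have h1 : 2 = (2 : R)%:C :> R[i] by rewrite rmorph_nat.
rewrite !h2 h1 !(onecE, zerocE, cE).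
by congr mx2; congr Complex; field; exact: D0.
Qed.

Lemma net_n_darboux (R : realType) (c p q t : R) :
    p ^+ 2 + q ^+ 2 = 1 ->
  net_n (fun u => darboux c p q (expR u)) t =
  imquat ((c ^+ 2 + expR t ^+ 2)^-1 *:
    vec3 (2 * c * expR t * q) (- (2 * c * expR t * p))
      (c ^+ 2 - expR t ^+ 2)).
Proof.
move=> pq; set l := expR t; have l0 : l != 0 by rewrite gt_eqF// expR_gt0.
have D0 : c ^+ 2 + l ^+ 2 != 0.
  by rewrite gt_eqF// ltr_wpDl ?sqr_ge0// exprn_even_gt0.
have [_ UV] := darboux_inv c pq l0.
rewrite /net_n UV /darboux /sigma3 -!scalemxAl !mx2_mul !mx2_scale.
rewrite vec3_scale imquat_vec3 -/l !(onecE, zerocE, cE).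
have cpq : c ^+ 2 = c ^+ 2 * (p ^+ 2 + q ^+ 2) by rewrite pq mulr1.
set D := (c ^+ 2 + l ^+ 2)^-1.
by congr mx2; congr Complex; rewrite 1?[in RHS]cpq; ring.
Qed.

Lemma amplitude_den (R : realType) (alpha t : R) :
  cosh t - cos alpha * sinh t =
  (sin (alpha / 2) ^+ 2 * expR t ^+ 2 + cos (alpha / 2) ^+ 2) / expR t.
Proof.
have e0 : expR t != 0 by rewrite gt_eqF// expR_gt0.
have -> : cosh t = (cos (alpha / 2) ^+ 2 + sin (alpha / 2) ^+ 2) * cosh t.
  by rewrite cos2Dsin2 mul1r.
rewrite (cos_double_half alpha).
by rewrite /cosh /sinh expRN; field.
Qed.

Lemma amplitude_num (R : realType) (alpha t : R) :
  cos alpha * cosh t - sinh t =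
  (cos (alpha / 2) ^+ 2 - sin (alpha / 2) ^+ 2 * expR t ^+ 2) / expR t.
Proof.
have e0 : expR t != 0 by rewrite gt_eqF// expR_gt0.
have -> : sinh t = (cos (alpha / 2) ^+ 2 + sin (alpha / 2) ^+ 2) * sinh t.
  by rewrite cos2Dsin2 mul1r.
rewrite (cos_double_half alpha).
by rewrite /cosh /sinh expRN; field.
Qed.

Lemma half_angle_den (R : realType) (alpha t : R) : sin (alpha / 2) != 0 ->
  cot (alpha / 2) ^+ 2 + expR t ^+ 2 =
  (sin (alpha / 2) ^+ 2 * expR t ^+ 2 + cos (alpha / 2) ^+ 2) /
    sin (alpha / 2) ^+ 2.
Proof. by move=> s0; rewrite /cot; field. Qed.

Lemma half_angle_den_neq0 (R : realType) (alpha t : R) :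
  sin (alpha / 2) != 0 ->
  sin (alpha / 2) ^+ 2 * expR t ^+ 2 + cos (alpha / 2) ^+ 2 != 0.
Proof.
move=> s0; rewrite gt_eqF// ltr_pwDl ?sqr_ge0// mulr_gt0 ?exprn_even_gt0//=.
by rewrite gt_eqF// expR_gt0.
Qed.

Lemma amplitudeE (R : realType) (alpha t : R) : sin alpha != 0 ->
  2 * cot (alpha / 2) * expR t / (cot (alpha / 2) ^+ 2 + expR t ^+ 2) =
  amplitude alpha t.
Proof.
move=> sa0; have [s0 c0] := half_neq0 sa0.
have e0 : expR t != 0 by rewrite gt_eqF// expR_gt0.
rewrite half_angle_den// /amplitude amplitude_den (sin_double_half alpha) /cot.
have := half_angle_den_neq0 t s0; set D := _ + _ => D0.
by field; rewrite D0 s0 e0.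
Qed.

Lemma amplitude_heightE (R : realType) (alpha t : R) : sin alpha != 0 ->
  (cot (alpha / 2) ^+ 2 - expR t ^+ 2) /
    (cot (alpha / 2) ^+ 2 + expR t ^+ 2) =
  amplitude alpha t * (cosh t * cot alpha - csc alpha * sinh t).
Proof.
move=> sa0; have [s0 c0] := half_neq0 sa0.
have e0 : expR t != 0 by rewrite gt_eqF// expR_gt0.
have -> : cosh t * cot alpha - csc alpha * sinh t =
    (cos alpha * cosh t - sinh t) / sin alpha.
  by rewrite /cot /csc; ring.
rewrite amplitude_num /amplitude amplitude_den half_angle_den// /cot.
have := half_angle_den_neq0 t s0; set D := _ + _ => D0.
by field; rewrite D0 s0 e0 sa0.
Qed.

Lemma backlund_frame_darboux (R : realType) (d1 d2 alpha theta : R)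
    (k ell : int) :
    expchi d1 d2 alpha theta k ell != 0 ->
  backlund_frame alpha (line_backlund d1 d2 alpha theta) (line_frame d1 d2)
    k ell =
  fun t => darboux (cot (alpha / 2)) (- tanhchi d1 d2 alpha theta k ell)
             (sechchi d1 d2 alpha theta k ell) (expR t) *m
           line_frame d1 d2 k ell t.
Proof.
move=> u0; apply/funext => t; rewrite /backlund_frame; congr (_ *m _).
have s0 := sqr1_neq0 (straight_sqr R k ell).
rewrite (backU_ratio _ _ s0 (erefl (line_backlund _ _ _ _ _ _))) /ratioU.
rewrite -unit_conj ?cay_unit// (cay_exp u0).
rewrite /darboux [conjc _]/= !cE -/(tanhchi d1 d2 alpha theta k ell).
rewrite -/(sechchi d1 d2 alpha theta k ell).
by congr mx2; congr Complex; ring.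
Qed.

(** * The transformed net *)

Theorem theorem2p10 (R : realType) (d1 d2 alpha theta : R)
    (alpha_range : - pi < alpha < pi) (alpha_neq0 : alpha != 0)
    (theta_range : - pi < theta < pi) (theta_neq0 : theta != 0)
    (sin_d1 : sin d1 != 0) (sincos_d2 : sin d2 * cos d2 != 0)
    (alpha_d1_minus : sin alpha != sin d1)
    (alpha_d1_plus : sin alpha != - sin d1)
    (alpha_d2_plus : sin (alpha + d2) != 0)
    (alpha_d2_minus : sin (alpha - d2) != 0) :
  exists (Phi0 : int -> int -> R -> 'M[R[i]]_2) (sb : int -> int -> R[i]),
    [/\ unique (is_straight_frame d1 d2) Phi0,
        unique (is_straight_backlund d1 d2 alpha theta) sb &
        forall (k ell : int) (t : R),
          [/\ net_f (Phi0 k ell) t = imquat (f0 d1 d2 k ell t),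
              net_f (backlund_frame alpha sb Phi0 k ell) t =
                imquat (fb d1 d2 alpha theta k ell t) &
              net_n (backlund_frame alpha sb Phi0 k ell) t =
                imquat (nb d1 d2 alpha theta k ell t)]].
Proof.
move: (sincos_d2); rewrite mulf_eq0 negb_or => /andP[sin_d2 cos_d2].
have sin_alpha := sin_neq0_pi alpha_range alpha_neq0.
have [st ct] := half_neq0 (sin_neq0_pi theta_range theta_neq0).
have tt : tan (theta / 2) != 0 by rewrite /tan mulf_neq0// invr_eq0.
have [sa _] := half_neq0 sin_alpha.
exists (line_frame d1 d2), (line_backlund d1 d2 alpha theta).
have frame := line_frameP sin_d1 sin_d2 cos_d2.
have backlund : is_straight_backlund d1 d2 alpha theta
    (line_backlund d1 d2 alpha theta) by exact: line_backlundP.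
split=> [|| k ell t].
- by split=> // Phi; exact: line_frame_unique.
- by split=> // sb; exact: line_backlund_unique.
have u0 : expchi d1 d2 alpha theta k ell != 0 by exact: expchi_neq0.
have pq := tanh_sech u0.
have g0 := frame_scale_neq0 k ell t sin_d1 sin_d2 cos_d2.
have Gu : line_frame d1 d2 k ell t \in unitmx by exact: scale_spin_unit.
have [Fu _] := darboux_inv (cot (alpha / 2)) pq (lt0r_neq0 (expR_gt0 t)).
have [F' dF] := is_dmx_line_frame k ell t sin_d1 sin_d2 cos_d2.
rewrite backlund_frame_darboux//; split; first exact: net_f_line_frame.
- rewrite (net_f_mul (is_dmx_darboux _ _ _ t) dF)// net_f_line_frame//.
  rewrite net_f_darboux// amplitudeE// /line_frame conj_scale_spin//.
  rewrite vec3_scale spin_conj -imquatD /fb omegaE vec3_scale /cis /= sinN cosN.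
  by congr (imquat (_ + vec3 _ _ _)); rewrite /tanhchi /sechchi; ring.
- rewrite net_n_mul// net_n_darboux// /line_frame conj_scale_spin//.
  have -> (p q : R) : (cot (alpha / 2) ^+ 2 + expR t ^+ 2)^-1 *:
      vec3 (2 * cot (alpha / 2) * expR t * q)
           (- (2 * cot (alpha / 2) * expR t * p))
           (cot (alpha / 2) ^+ 2 - expR t ^+ 2) =
      vec3 (amplitude alpha t * q) (- (amplitude alpha t * p))
        (amplitude alpha t * (cosh t * cot alpha - csc alpha * sinh t)).
    by rewrite vec3_scale -amplitude_heightE// -amplitudeE//; congr vec3; ring.
  rewrite spin_conj /nb /omegahat omegaE vec3_scale /cis /= sinN cosN.
  by congr (imquat (vec3 _ _ _)); ring.
Qed.
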